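(* Let $\varphi:\mathbb{D}\to\mathbb{D}$ be an analytic self-map and $w\in H^\infty$, and consider the weighted composition operator $C_{w,\varphi}$ on $H^\infty$. If $$\liminf_{n\to\infty}\|w^{(n)}\|_\infty=0,$$ then the following assertions are equivalent: (i) $C_{w,\varphi}$ is Li--Yorke chaotic on $H^\infty$; (ii) $C_{w,\varphi}$ has a residual set of irregular vectors in $H^\infty$; (iii) $C_{w,\varphi}$ is not power-bounded on $H^\infty$.
   Context: $\mathbb{D}$ is the open unit disk in $\mathbb{C}$, $\mathbb{N}=\{1,2,\dots\}$. $H^\infty$ is the Banach space of bounded analytic functions on $\mathbb{D}$ with $\|f\|_\infty=\sup_{z\in\mathbb{D}}|f(z)|$. The weighted composition operator is $C_{w,\varphi}f=w\cdot(f\circ\varphi)$; $\varphi^n$ denotes the $n$-fold iterate of $\varphi$; and $w^{(1)}=w$, $w^{(n)}=(w\circ\varphi^{n-1})\cdots(w\circ\varphi)\cdot w$ for $n\ge2$, so that $(C_{w,\varphi})^nf=w^{(n)}\cdot(f\circ\varphi^n)$. Let $T$ be a bounded operator on a Banach space $X$. $T$ is Li--Yorke chaotic if there is an uncountable set $S\subset X$ such that for all distinct $x,y\in S$, $\liminf_{n\to\infty}\|T^nx-T^ny\|=0$ and $\limsup_{n\to\infty}\|T^nx-T^ny\|>0$. A vector $x$ is irregular for $T$ if $\liminf_{n\to\infty}\|T^nx\|=0$ and $\limsup_{n\to\infty}\|T^nx\|=\infty$. $T$ is power-bounded if $\sup_{n\in\mathbb{N}}\|T^n\|<\infty$. A subset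 of $X$ is residual if its complement is of first category (meager). *)

(* Defs.v *)
From Stdlib Require Import Reals Lra Classical FunctionalExtensionality.
From Coquelicot Require Import Coquelicot.

Set Implicit Arguments.
Unset Strict Implicit.

Open Scope R_scope.

Definition disc : Type := {z : C | Cmod z < 1}.

Definition disc_val (z : disc) : C := proj1_sig z.
Coercion disc_val : disc >-> C.

(* Extension by zero to the whole plane; since the disk is open, the value
   chosen outside is irrelevant for differentiability at points of the disk. *)
Definition ext0 (f : disc -> C) (z : C) : C :=
  match Rlt_dec (Cmod z) 1 with
  | left h => f (exist _ z h)
  | right _ => RtoC 0
  end.

(* The derivative is the complex one: the scalar ring is C, so analytic means
   holomorphic. *)
Definition analytic (f : disc -> C) : Prop :=
  forall z : disc, @ex_derive C_AbsRing C_NormedModule (ext0 f) (disc_val z).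

Definition bounded (f : disc -> C) : Prop :=
  exists M : R, forall z : disc, Cmod (f z) <= M.

Lemma ext0_in (f : disc -> C) (z : disc) : ext0 f z = f z.
Proof.
  destruct z as [z hz]; unfold ext0; simpl.
  destruct (Rlt_dec (Cmod z) 1) as [h|h]; [|contradiction].
  now rewrite (proof_irrelevance _ h hz).
Qed.

Lemma ext0_eq (f : disc -> C) (z : C) (h : Cmod z < 1) :
  ext0 f z = f (exist _ z h).
Proof. exact (ext0_in f (exist _ z h)). Qed.

Lemma disc_open (z : disc) :
  @locally (AbsRing_UniformSpace C_AbsRing) (disc_val z)
    (fun y : C => Cmod y < 1).
Proof.
  destruct z as [z hz]; simpl.
  assert (he : 0 < 1 - Cmod z) by lra.
  exists (mkposreal _ he); intros y Hy.
  change (Cmod (y - z)%C < 1 - Cmod z) in Hy.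
  replace y with ((y - z) + z)%C by ring.
  eapply Rle_lt_trans; [apply Cmod_triangle|]; lra.
Qed.

Lemma analytic_ext_loc (f : disc -> C) (F : C -> C) :
  (forall z : disc, F z = f z) ->
  (forall z : disc, @ex_derive C_AbsRing C_NormedModule F (disc_val z)) -> analytic f.
Proof.
  intros HF Hd z.
  apply (@ex_derive_ext_loc C_AbsRing C_NormedModule F).
  - generalize (disc_open z); apply filter_imp; intros y hy.
    rewrite (ext0_eq f hy); exact (HF (exist _ y hy)).
  - apply Hd.
Qed.

Lemma ex_derive_C_AbsRing (F : C -> C) (z : C) :
  @ex_derive C_AbsRing C_NormedModule F z <->
  @ex_derive C_AbsRing (AbsRing_NormedModule C_AbsRing) F z.
Proof.
  split; intros [l [[H1 H2 H3] Hd]]; exists l; split.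
  - constructor; [exact H1|exact H2|exact H3].
  - exact Hd.
  - constructor; [exact H1|exact H2|exact H3].
  - exact Hd.
Qed.

Lemma analytic_const (c : C) : analytic (fun _ => c).
Proof.
  apply (@analytic_ext_loc _ (fun _ => c)); [reflexivity|intros z].
  apply (@ex_derive_const C_AbsRing C_NormedModule).
Qed.

Lemma analytic_plus (f g : disc -> C) :
  analytic f -> analytic g -> analytic (fun z => Cplus (f z) (g z)).
Proof.
  intros Hf Hg.
  apply (@analytic_ext_loc _ (fun z => Cplus (ext0 f z) (ext0 g z))).
  - intros z; now rewrite !ext0_in.
  - intros z; exact (@ex_derive_plus C_AbsRing C_NormedModule _ _ _ (Hf z) (Hg z)).
Qed.

Lemma analytic_mult (f g : disc -> C) :
  analytic f -> analytic g -> analytic (fun z => Cmult (f z) (g z)).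
Proof.
  intros Hf Hg.
  apply (@analytic_ext_loc _ (fun z => Cmult (ext0 f z) (ext0 g z))).
  - intros z; now rewrite !ext0_in.
  - intros z; apply ex_derive_C_AbsRing.
    destruct (proj1 (ex_derive_C_AbsRing _ _) (Hf z)) as [lf Df].
    destruct (proj1 (ex_derive_C_AbsRing _ _) (Hg z)) as [lg Dg].
    exists (lf * ext0 g z + ext0 f z * lg)%C.
    refine (filterdiff_ext_lin (K := C_AbsRing)
      (U := AbsRing_NormedModule C_AbsRing) (V := AbsRing_NormedModule C_AbsRing)
      _ _ _
      (@filterdiff_mult_fct C_AbsRing (AbsRing_NormedModule C_AbsRing)
         (ext0 f) (ext0 g) (disc_val z) _ _ Cmult_comm Df Dg) _).
    intros y.
    change (y * lf * ext0 g z + ext0 f z * (y * lg)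
      = y * (lf * ext0 g z + ext0 f z * lg))%C.
    ring.
Qed.

Lemma analytic_comp (f : disc -> C) (phi : disc -> disc) :
  analytic f -> analytic (fun z => phi z) -> analytic (fun z => f (phi z)).
Proof.
  intros Hf Hphi.
  apply (@analytic_ext_loc _
    (fun z => ext0 f (ext0 (fun x => disc_val (phi x)) z))).
  - intros z; now rewrite (ext0_in (fun x => disc_val (phi x))), ext0_in.
  - intros z.
    apply (@ex_derive_comp C_AbsRing C_NormedModule (ext0 f)).
    + rewrite (ext0_in (fun x => disc_val (phi x))); apply Hf.
    + apply ex_derive_C_AbsRing, Hphi.
Qed.

Record Hinf : Type := mkHinf {
  Hfun :> disc -> C;
  Hfun_analytic : analytic Hfun;
  Hfun_bounded : bounded Hfun }.

Lemma Hinf_ext (f g : Hinf) : (forall z : disc, f z = g z) -> f = g.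
Proof.
  destruct f as [f fa fb], g as [g ga gb]; simpl; intros H.
  assert (E : f = g) by now apply functional_extensionality.
  subst g; f_equal; apply proof_irrelevance.
Qed.

(* The set is bounded above and nonempty for f in H^oo, so [real] loses
   nothing. *)
Definition Hnorm (f : Hinf) : R :=
  real (Lub_Rbar (fun r => exists z : disc, r = Cmod (f z))).

Definition disc0 : disc.
Proof. exists (RtoC 0); rewrite Cmod_0; exact Rlt_0_1. Defined.

Lemma Hnorm_lub (f : Hinf) :
  is_lub_Rbar (fun r => exists z : disc, r = Cmod (f z)) (Finite (Hnorm f)).
Proof.
  unfold Hnorm.
  pose proof (Lub_Rbar_correct (fun r => exists z : disc, r = Cmod (f z))) as H.
  destruct (Hfun_bounded f) as [M HM].
  destruct (Lub_Rbar _) as [l| |]; simpl; auto.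
  - exfalso; refine (proj2 H (Finite M) _).
    intros r [z ->]; apply HM.
  - exfalso; refine (proj1 H (Cmod (f disc0)) _).
    now exists disc0.
Qed.

Lemma Hnorm_ub (f : Hinf) (z : disc) : Cmod (f z) <= Hnorm f.
Proof. apply (proj1 (Hnorm_lub f)); now exists z. Qed.

Lemma Hnorm_le (f : Hinf) (M : R) :
  (forall z : disc, Cmod (f z) <= M) -> Hnorm f <= M.
Proof. intros H; apply (proj2 (Hnorm_lub f) (Finite M)); intros r [z ->]; apply H. Qed.

Lemma Hnorm_ge0 (f : Hinf) : 0 <= Hnorm f.
Proof. eapply Rle_trans; [apply Cmod_ge_0|apply (Hnorm_ub f disc0)]. Qed.

Definition Hconst (c : C) : Hinf.
Proof.
  refine (@mkHinf (fun _ => c) (analytic_const c) _).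
  exists (Cmod c); intros _; apply Rle_refl.
Defined.

Definition Hplus (f g : Hinf) : Hinf.
Proof.
  refine (@mkHinf (fun z => Cplus (f z) (g z))
            (analytic_plus (Hfun_analytic f) (Hfun_analytic g)) _).
  exists (Hnorm f + Hnorm g); intros z.
  eapply Rle_trans; [apply Cmod_triangle|].
  apply Rplus_le_compat; apply Hnorm_ub.
Defined.

Definition Hmult (f g : Hinf) : Hinf.
Proof.
  refine (@mkHinf (fun z => Cmult (f z) (g z))
            (analytic_mult (Hfun_analytic f) (Hfun_analytic g)) _).
  exists (Hnorm f * Hnorm g); intros z.
  rewrite Cmod_mult.
  apply Rmult_le_compat; try apply Cmod_ge_0; apply Hnorm_ub.
Defined.

Definition Hscal (c : C) (f : Hinf) : Hinf := Hmult (Hconst c) f.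

Definition Hopp (f : Hinf) : Hinf := Hscal (RtoC (-1)) f.

Definition Hinf_AbelianMonoid_mixin : AbelianMonoid.mixin_of Hinf.
Proof.
  refine (@AbelianMonoid.Mixin Hinf Hplus (Hconst (RtoC 0)) _ _ _);
    intros; apply Hinf_ext; intros t; simpl; ring.
Defined.

Canonical Hinf_AbelianMonoid :=
  AbelianMonoid.Pack Hinf Hinf_AbelianMonoid_mixin Hinf.

Definition Hinf_AbelianGroup_mixin :
  AbelianGroup.mixin_of Hinf_AbelianMonoid.
Proof.
  refine (@AbelianGroup.Mixin Hinf_AbelianMonoid Hopp _).
  intros x; apply Hinf_ext; intros t; simpl; ring.
Defined.

Canonical Hinf_AbelianGroup :=
  AbelianGroup.Pack Hinf (AbelianGroup.Class Hinf _ Hinf_AbelianGroup_mixin) Hinf.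

Definition Hinf_ModuleSpace_mixin :
  ModuleSpace.mixin_of C_Ring Hinf_AbelianGroup.
Proof.
  refine (@ModuleSpace.Mixin C_Ring Hinf_AbelianGroup Hscal _ _ _ _);
    intros; apply Hinf_ext; intros t; simpl; try ring.
  - change (x * (y * u t) = x * y * u t)%C; ring.
  - change (1 * u t = u t)%C; ring.
  - change ((x + y) * u t = x * u t + y * u t)%C; ring.
Defined.

Canonical Hinf_ModuleSpace :=
  ModuleSpace.Pack C_Ring Hinf (ModuleSpace.Class C_Ring Hinf _ Hinf_ModuleSpace_mixin) Hinf.

Definition Hball (f : Hinf) (eps : R) (g : Hinf) : Prop :=
  Hnorm (Hplus g (Hopp f)) < eps.

Lemma Hnorm_triangle (f g : Hinf) : Hnorm (Hplus f g) <= Hnorm f + Hnorm g.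
Proof.
  apply Hnorm_le; intros z; simpl.
  eapply Rle_trans; [apply Cmod_triangle|].
  apply Rplus_le_compat; apply Hnorm_ub.
Qed.

Lemma Hnorm_mult (f g : Hinf) : Hnorm (Hmult f g) <= Hnorm f * Hnorm g.
Proof.
  apply Hnorm_le; intros z; simpl; rewrite Cmod_mult.
  apply Rmult_le_compat; try apply Cmod_ge_0; apply Hnorm_ub.
Qed.

Lemma Hnorm_scal (c : C) (f : Hinf) : Hnorm (Hscal c f) <= Cmod c * Hnorm f.
Proof.
  apply Hnorm_le; intros z; simpl; rewrite Cmod_mult.
  apply Rmult_le_compat_l; [apply Cmod_ge_0|apply Hnorm_ub].
Qed.

Lemma Hnorm_eq0 (f : Hinf) : Hnorm f = 0 -> f = Hconst (RtoC 0).
Proof.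
  intros H; apply Hinf_ext; intros z; simpl.
  apply Cmod_eq_0, Rle_antisym; [|apply Cmod_ge_0].
  rewrite <- H; apply Hnorm_ub.
Qed.

Definition Hinf_UniformSpace_mixin : UniformSpace.mixin_of Hinf.
Proof.
  refine (@UniformSpace.Mixin Hinf (Hconst (RtoC 0)) Hball _ _ _); unfold Hball.
  - intros f e; eapply Rle_lt_trans; [|apply (cond_pos e)].
    apply Hnorm_le; intros z; simpl; apply Req_le.
    rewrite <- Cmod_0; f_equal; ring.
  - intros f g e H; eapply Rle_lt_trans; [|exact H].
    apply Hnorm_le; intros z.
    eapply Rle_trans; [|apply (Hnorm_ub _ z)]; simpl.
    rewrite <- Cmod_opp; apply Req_le; f_equal; ring.
  - intros f g h e1 e2 H1 H2.
    eapply Rle_lt_trans; [|apply (Rplus_lt_compat _ _ _ _ H1 H2)].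
    eapply Rle_trans; [|apply Hnorm_triangle].
    apply Req_le; f_equal; apply Hinf_ext; intros z; simpl; ring.
Defined.

Canonical Hinf_UniformSpace :=
  UniformSpace.Pack Hinf Hinf_UniformSpace_mixin Hinf.

Canonical Hinf_NormedModuleAux :=
  NormedModuleAux.Pack C_AbsRing Hinf
    (NormedModuleAux.Class C_AbsRing Hinf
       (ModuleSpace.class C_Ring Hinf_ModuleSpace)
       (UniformSpace.class Hinf_UniformSpace)) Hinf.

Definition Hinf_NormedModule_mixin :
  NormedModule.mixin_of C_AbsRing Hinf_NormedModuleAux.
Proof.
  refine (@NormedModule.Mixin C_AbsRing Hinf_NormedModuleAux Hnorm 1 _ _ _ _ _).
  - exact Hnorm_triangle.
  - exact Hnorm_scal.
  - intros x y eps H; exact H.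
  - intros x y eps H; rewrite Rmult_1_l; exact H.
  - exact Hnorm_eq0.
Defined.

Canonical Hinf_NormedModule :=
  NormedModule.Pack C_AbsRing Hinf
    (NormedModule.Class C_AbsRing Hinf
       (NormedModuleAux.class C_AbsRing Hinf_NormedModuleAux)
       Hinf_NormedModule_mixin) Hinf.

Record analytic_self_map : Type := mkASM {
  asm_fun :> disc -> disc;
  asm_analytic : analytic (fun z => asm_fun z) }.

Definition asm_comp (phi psi : analytic_self_map) : analytic_self_map :=
  @mkASM (fun z => phi (psi z))
    (analytic_comp (asm_analytic phi) (asm_analytic psi)).

Lemma analytic_id : analytic (fun z => z).
Proof.
  apply (@analytic_ext_loc _ (fun z => z)); [reflexivity|intros z].
  apply ex_derive_C_AbsRing, ex_derive_id.
Qed.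

Definition asm_id : analytic_self_map := @mkASM (fun z => z) analytic_id.

Definition asm_iter (phi : analytic_self_map) (n : nat) : analytic_self_map :=
  Nat.iter n (asm_comp phi) asm_id.

Definition Hcomp (f : Hinf) (phi : analytic_self_map) : Hinf.
Proof.
  refine (@mkHinf (fun z => f (phi z))
            (analytic_comp (Hfun_analytic f) (asm_analytic phi)) _).
  exists (Hnorm f); intros z; apply Hnorm_ub.
Defined.

Definition wcomp (w : Hinf) (phi : analytic_self_map) (f : Hinf) : Hinf :=
  Hmult w (Hcomp f phi).

(* The empty product [wprod w phi 0 = 1] extends the family w^(n), n >= 1. *)
Fixpoint wprod (w : Hinf) (phi : analytic_self_map) (n : nat) : Hinf :=
  match n with
  | O => Hconst (RtoC 1)
  | S m => Hmult (Hcomp w (asm_iter phi m)) (wprod w phi m)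
  end.

Lemma wcomp_is_linear (w : Hinf) (phi : analytic_self_map) :
  is_linear (wcomp w phi).
Proof.
  constructor.
  - intros f g; apply Hinf_ext; intros z; simpl; ring.
  - intros c f; apply Hinf_ext; intros z.
    change (w z * (c * f (phi z)) = c * (w z * f (phi z)))%C; ring.
  - exists (Hnorm w + 1); split; [generalize (Hnorm_ge0 w); lra|intros f].
    change (Hnorm (wcomp w phi f) <= (Hnorm w + 1) * Hnorm f).
    eapply Rle_trans; [apply Hnorm_mult|].
    apply Rmult_le_compat; try apply Hnorm_ge0; [lra|].
    apply Hnorm_le; intros z; exact (Hnorm_ub f (phi z)).
Qed.

Lemma wcomp_iter (w : Hinf) (phi : analytic_self_map) (n : nat) (f : Hinf) :
  Nat.iter n (wcomp w phi) f = Hmult (wprod w phi n) (Hcomp f (asm_iter phi n)).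
Proof.
  assert (Hp : forall n z, asm_iter phi n (phi z) = phi (asm_iter phi n z)).
  { intros k; induction k as [|k IH]; intros z; [reflexivity|].
    change (phi (asm_iter phi k (phi z)) = phi (phi (asm_iter phi k z))).
    now rewrite IH. }
  assert (Hw : forall n z,
    wprod w phi (S n) z = (w z * wprod w phi n (phi z))%C).
  { intros k; induction k as [|k IH]; intros z; [reflexivity|].
    change (wprod w phi (S (S k)) z) with
      (w (phi (asm_iter phi k z)) * wprod w phi (S k) z)%C.
    rewrite IH.
    change (wprod w phi (S k) (phi z)) with
      (w (asm_iter phi k (phi z)) * wprod w phi k (phi z))%C.
    rewrite Hp; ring. }
  induction n as [|n IH]; apply Hinf_ext; intros z.
  - simpl; ring.
  - change (w z * Nat.iter n (wcomp w phi) f (phi z)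
      = wprod w phi (S n) z * f (phi (asm_iter phi n z)))%C.
    rewrite IH, Hw; simpl; rewrite Hp; ring.
Qed.

Definition countable_set {X : Type} (S : X -> Prop) : Prop :=
  exists g : X -> nat, forall x y, S x -> S y -> g x = g y -> x = y.

(* The sequences below start at n = 0 rather than n = 1; this does not affect
   lower and upper limits. *)
Definition li_yorke_chaotic {X : NormedModule C_AbsRing} (T : X -> X) : Prop :=
  exists S : X -> Prop, ~ countable_set S /\
    forall x y, S x -> S y -> x <> y ->
      LimInf_seq (fun n => norm (minus (Nat.iter n T x) (Nat.iter n T y)))
        = Finite 0 /\
      Rbar_lt (Finite 0)
        (LimSup_seq (fun n => norm (minus (Nat.iter n T x) (Nat.iter n T y)))).

Definition irregular {X : NormedModule C_AbsRing} (T : X -> X) (x : X) : Prop :=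
  LimInf_seq (fun n => norm (Nat.iter n T x)) = Finite 0 /\
  LimSup_seq (fun n => norm (Nat.iter n T x)) = p_infty.

Definition op_norm {X : NormedModule C_AbsRing} (T : X -> X) : Rbar :=
  Lub_Rbar (fun r => exists x : X, norm x <= 1 /\ r = norm (T x)).

Definition power_bounded {X : NormedModule C_AbsRing} (T : X -> X) : Prop :=
  Rbar_lt (Sup_seq (fun n => op_norm (Nat.iter (S n) T))) p_infty.

Definition closure {X : UniformSpace} (A : X -> Prop) (x : X) : Prop :=
  forall U : X -> Prop, locally x U -> exists y, U y /\ A y.

Definition nowhere_dense {X : UniformSpace} (A : X -> Prop) : Prop :=
  forall x : X, ~ locally x (closure A).

Definition meager {X : UniformSpace} (A : X -> Prop) : Prop :=
  exists N : nat -> X -> Prop,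
    (forall k, nowhere_dense (N k)) /\ (forall x, A x -> exists k, N k x).

Definition residual {X : UniformSpace} (A : X -> Prop) : Prop :=
  meager (fun x => ~ A x).

(* Main.v *)
(* Write T for the weighted composition operator. Since T^n 1 = w^(n), one has
   ||T^n|| = ||w^(n)||, so a power bounded T satisfies T^n -> 0 and has neither
   irregular vectors nor Li-Yorke pairs. If T is not power bounded, every f with
   an unbounded orbit is irregular, and by the Banach-Steinhaus argument the set
   of the others is meager; moreover 1 is irregular, so the constant functions
   form an uncountable scrambled set.

   That a residual set is nonempty is Baire's theorem, which needs the
   completeness of H^oo, that is, that uniform limits of holomorphic functions
   are holomorphic. This comes from Goursat's theorem for rectangles: applied to
   (F z - F a - F'(a) (z - a)) / (z - a)^2 it gives |F'(a)| <= 4 M / s, hence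
   difference quotients converge uniformly. *)

Require Import Defs.
From Stdlib Require Import Reals Lra Lia Classical IndefiniteDescription FunctionalExtensionality.
From Coquelicot Require Import Coquelicot.

Set Implicit Arguments.
Unset Strict Implicit.

Open Scope R_scope.

(** * Complex derivatives *)

(** Analyticity is bare complex differentiability, with no continuity of the derivative; hence
    Goursat's bisection rather than Green's formula. With rectangles, each contour integral is a
    combination of four Riemann integrals over segments. The function to which the theorem is
    applied is singular at a, but of size o(1/|z - a|), so its integral over a square tends to 0 as
    the square shrinks to a. What remains is F'(a) times the integral of 1/(z - a), equal to the
    integral of (F z - F a)/(z - a)^2, over a square of half-side s. If |F| <= M, the right side is
    at most the perimeter 8 s times 2 M / s^2, that is 16 M / s; on the left only the lower bound 4
    for the modulus of the integral enters, so neither pi nor a logarithm appears, and the quotient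
    is 4 M / s.

    On the dynamical side, the lower limit 0 brings every orbit near 0 along times common to all
    vectors. For power bounded T it becomes a limit by submultiplicativity of ||w^(n)||. Baire's
    theorem serves a second time, on the real line, for the uncountability of the constants. *)

Definition Cdiff (F : C -> C) (z l : C) : Prop :=
  forall eps, 0 < eps -> exists delta, 0 < delta /\
    forall y : C, Cmod (y - z) < delta ->
      Cmod (F y - F z - l * (y - z)) <= eps * Cmod (y - z).

(** Passage from filters to estimates in [Cmod]: bisection, the Cauchy estimate and the uniform
    limit all work with the epsilon-delta form. *)
Lemma is_derive_Cdiff (F : C -> C) (z l : C) :
  @is_derive C_AbsRing C_NormedModule F z l <-> Cdiff F z l.
Proof.
  split.
  - intros [_ Hd] eps heps.
    destruct (Hd z (fun P HP => HP) (mkposreal _ heps)) as [d Hd'].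
    exists d; split; [apply cond_pos|intros y Hy].
    replace (F y - F z - l * (y - z))%C with (F y - F z - (y - z) * l)%C by ring.
    exact (Hd' y Hy).
  - intros H; split.
    + apply (@is_linear_scal_l C_AbsRing C_NormedModule).
    (* The differential is tested at every limit [x] of the filter [locally z]; by uniqueness of
       limits only [z] occurs. *)
    + intros x Hx.
      assert (E : z = x).
      { apply (@is_filter_lim_locally_unique C_AbsRing (AbsRing_NormedModule C_AbsRing)).
        exact Hx. }
      subst x; intros eps.
      destruct (H eps (cond_pos eps)) as [d [hd Hd]].
      exists (mkposreal d hd); intros y Hy.
      change (Cmod (F y - F z - (y - z) * l) <= eps * Cmod (y - z)).
      replace (F y - F z - (y - z) * l)%C with (F y - F z - l * (y - z))%C by ring.
      exact (Hd y Hy).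
Qed.

Definition Ccont (F : C -> C) (z : C) : Prop :=
  forall eps, 0 < eps -> exists delta, 0 < delta /\
    forall y : C, Cmod (y - z) < delta -> Cmod (F y - F z) < eps.

Lemma Cmod_sub_sym (a b : C) : Cmod (a - b) = Cmod (b - a).
Proof. rewrite <- Cmod_opp; f_equal; ring. Qed.

Lemma Cmod_triangle_sub (a b : C) : Cmod (a - b) <= Cmod a + Cmod b.
Proof. rewrite <- (Cmod_opp b); apply Cmod_triangle. Qed.

Lemma Cmod_triangle_rev (a b : C) : Cmod a - Cmod b <= Cmod (a - b).
Proof.
  pose proof (Cmod_triangle (a - b) b) as H.
  replace (a - b + b)%C with a in H by ring; lra.
Qed.

Lemma Cdiff_lipschitz (F : C -> C) (z l : C) :
  Cdiff F z l -> exists delta, 0 < delta /\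
    forall y : C, Cmod (y - z) < delta ->
      Cmod (F y - F z) <= (Cmod l + 1) * Cmod (y - z).
Proof.
  intros H; destruct (H 1 Rlt_0_1) as [d [hd Hd]].
  exists d; split; [exact hd|intros y Hy].
  replace (F y - F z)%C with ((F y - F z - l * (y - z)) + l * (y - z))%C by ring.
  eapply Rle_trans; [apply Cmod_triangle|]; rewrite Cmod_mult.
  specialize (Hd y Hy); lra.
Qed.

Lemma Cdiff_cont (F : C -> C) (z l : C) : Cdiff F z l -> Ccont F z.
Proof.
  intros H eps heps; destruct (Cdiff_lipschitz H) as [d [hd Hd]].
  pose proof (Cmod_ge_0 l) as hl.
  assert (hq : 0 < eps / (Cmod l + 1)) by (apply Rdiv_lt_0_compat; lra).
  exists (Rmin d (eps / (Cmod l + 1))); split; [now apply Rmin_pos|intros y Hy].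
  eapply Rle_lt_trans.
  - apply Hd; eapply Rlt_le_trans; [exact Hy|apply Rmin_l].
  - apply Rlt_le_trans with ((Cmod l + 1) * (eps / (Cmod l + 1))).
    + apply Rmult_lt_compat_l; [lra|].
      eapply Rlt_le_trans; [exact Hy|apply Rmin_r].
    + right; field; lra.
Qed.

Lemma Cdiff_ext (F G : C -> C) (z l : C) :
  (forall y, F y = G y) -> Cdiff F z l -> Cdiff G z l.
Proof.
  intros E H eps heps; destruct (H eps heps) as [d [hd Hd]].
  exists d; split; [exact hd|intros y Hy].
  rewrite <- !E; exact (Hd y Hy).
Qed.

Lemma Cdiff_mult (F G : C -> C) (z l m : C) :
  Cdiff F z l -> Cdiff G z m ->
  Cdiff (fun y => F y * G y)%C z (l * G z + F z * m)%C.
Proof.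
  intros HF HG; apply is_derive_Cdiff.
  apply is_derive_Cdiff in HF; apply is_derive_Cdiff in HG.
  (* The product rule lives on C as a module over itself. Both module structures have the same
     operations, so the linearity record is rebuilt field by field. *)
  assert (conv : forall f w k, @is_derive C_AbsRing C_NormedModule f w k <->
    @is_derive C_AbsRing (AbsRing_NormedModule C_AbsRing) f w k).
  { intros f w k; split; intros [[H1 H2 H3] H4]; split; try exact H4;
      constructor; assumption. }
  apply conv; apply conv in HF; apply conv in HG.
  exact (@is_derive_mult C_AbsRing F G z l m HF HG Cmult_comm).
Qed.

Lemma Cdiff_affine (A B z : C) : Cdiff (fun y => A + B * y)%C z B.
Proof.
  intros eps heps; exists 1; split; [lra|intros y _].
  replace (A + B * y - (A + B * z) - B * (y - z))%C with (RtoC 0) by ring.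
  rewrite Cmod_0; apply Rmult_le_pos; [lra|apply Cmod_ge_0].
Qed.

Lemma Cdiff_plus (F G : C -> C) (z l m : C) :
  Cdiff F z l -> Cdiff G z m -> Cdiff (fun y => F y + G y)%C z (l + m)%C.
Proof.
  intros HF HG eps heps.
  destruct (HF (eps / 2)) as [d1 [h1 H1]]; [lra|].
  destruct (HG (eps / 2)) as [d2 [h2 H2]]; [lra|].
  exists (Rmin d1 d2); split; [now apply Rmin_pos|intros y Hy].
  specialize (H1 y (Rlt_le_trans _ _ _ Hy (Rmin_l _ _))).
  specialize (H2 y (Rlt_le_trans _ _ _ Hy (Rmin_r _ _))).
  replace (F y + G y - (F z + G z) - (l + m) * (y - z))%C
    with ((F y - F z - l * (y - z)) + (G y - G z - m * (y - z)))%C by ring.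
  eapply Rle_trans; [apply Cmod_triangle|]; lra.
Qed.

Lemma Cdiff_scal (c : C) (F : C -> C) (z l : C) :
  Cdiff F z l -> Cdiff (fun y => c * F y)%C z (c * l)%C.
Proof.
  intros HF.
  replace (c * l)%C with (0 * F z + (c + 0 * z) * l)%C by ring.
  apply (@Cdiff_ext (fun y => (c + 0 * y) * F y)%C); [intros y; ring|].
  exact (Cdiff_mult (Cdiff_affine c 0 z) HF).
Qed.

Lemma Cdiff_inv (a z : C) : z <> a ->
  Cdiff (fun y => / (y - a))%C z (- / ((z - a) * (z - a)))%C.
Proof.
  intros hz eps heps.
  assert (hza : (z - a)%C <> 0).
  { intros E; apply hz; replace z with ((z - a) + a)%C by ring; rewrite E; ring. }
  set (r := Cmod (z - a)).
  assert (hr : 0 < r) by (now apply Cmod_gt_0).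
  assert (hq : 0 < eps * (r * r * r / 2)).
  { apply Rmult_lt_0_compat; [lra|].
    assert (0 < r * r * r) by (repeat apply Rmult_lt_0_compat; assumption); lra. }
  (* For |y - z| < r/2 the point [y] stays at distance at least r/2 from [a]. The remainder is
     exactly (y - z)^2 / ((z - a)^2 (y - a)), hence at most 2 |y - z|^2 / r^3; this dictates the
     second radius. *)
  exists (Rmin (r / 2) (eps * (r * r * r / 2))); split; [apply Rmin_pos; lra|].
  intros y Hy.
  pose proof (Rlt_le_trans _ _ _ Hy (Rmin_l _ _)) as Hy1.
  pose proof (Rlt_le_trans _ _ _ Hy (Rmin_r _ _)) as Hy2.
  assert (hya : r / 2 <= Cmod (y - a)).
  { pose proof (Cmod_triangle_rev (z - a) (z - y)) as H.
    replace (z - a - (z - y))%C with (y - a)%C in H by ring.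
    rewrite (Cmod_sub_sym z y) in H; fold r in H; lra. }
  assert (hyn : (y - a)%C <> 0) by (apply Cmod_gt_0; lra).
  replace (/ (y - a) - / (z - a) - - / ((z - a) * (z - a)) * (y - z))%C
    with ((y - z) * (y - z) / ((z - a) * (z - a) * (y - a)))%C
    by (field; split; assumption).
  rewrite Cmod_div by (repeat apply Cmult_neq_0; assumption).
  rewrite !Cmod_mult; fold r.
  apply Rle_div_l; [repeat apply Rmult_lt_0_compat; lra|].
  replace (eps * Cmod (y - z) * (r * r * Cmod (y - a)))
    with (Cmod (y - z) * (eps * (r * r * Cmod (y - a)))) by ring.
  apply Rmult_le_compat_l; [apply Cmod_ge_0|].
  apply Rlt_le, Rlt_le_trans with (1 := Hy2).
  apply Rmult_le_compat_l; [lra|].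
  replace (r * r * r / 2) with (r * r * (r / 2)) by field.
  apply Rmult_le_compat_l; [apply Rmult_le_pos; lra|exact hya].
Qed.

(** * Integrals over rectangles *)
Definition CRInt (f : R -> C) (a b : R) : C :=
  @RInt C_R_CompleteNormedModule f a b.

Definition ex_CRInt (f : R -> C) (a b : R) : Prop :=
  @ex_RInt C_R_CompleteNormedModule f a b.

Lemma Cmod_norm_R (z : C) : @norm R_AbsRing C_R_NormedModule z = Cmod z.
Proof.
  change (sqrt (Rabs (fst z) ^ 2 + Rabs (snd z) ^ 2) = Cmod z).
  unfold Cmod; now rewrite !pow2_abs.
Qed.

Lemma CRInt_bound (f : R -> C) (a b B : R) :
  a <= b -> ex_CRInt f a b ->
  (forall t, a <= t <= b -> Cmod (f t) <= B) -> Cmod (CRInt f a b) <= (b - a) * B.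
Proof.
  intros hab Hex HB.
  rewrite <- Cmod_norm_R.
  refine (@norm_RInt_le_const C_R_NormedModule f a b _ B hab _ (RInt_correct _ _ _ Hex)).
  intros t Ht; rewrite Cmod_norm_R; exact (HB t Ht).
Qed.

Lemma ex_CRInt_cont (f : R -> C) (a b : R) :
  a <= b ->
  (forall t, a <= t <= b -> forall eps, 0 < eps -> exists delta, 0 < delta /\
     forall u, Rabs (u - t) < delta -> Cmod (f u - f t) < eps) ->
  ex_CRInt f a b.
Proof.
  intros hab H; apply ex_RInt_continuous.
  rewrite Rmin_left, Rmax_right by exact hab.
  intros t Ht; apply filterlim_locally; intros eps.
  destruct (H t Ht eps (cond_pos eps)) as [d [hd Hd]].
  exists (mkposreal d hd); intros u Hu.
  specialize (Hd u Hu).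
  (* Balls of C as a product are boxes; the disc of the same radius lies inside. *)
  apply C_NormedModule_mixin_compat1; exact Hd.
Qed.

Lemma ex_CRInt_horizontal (f : C -> C) (a b y : R) : a <= b ->
  (forall t, a <= t <= b -> Ccont f (t, y)) -> ex_CRInt (fun t => f (t, y)) a b.
Proof.
  intros hab H; apply ex_CRInt_cont; [exact hab|].
  intros t Ht eps heps; destruct (H t Ht eps heps) as [d [hd Hd]].
  exists d; split; [exact hd|intros u Hu; apply Hd].
  replace ((u, y) - (t, y))%C with (RtoC (u - t)).
  - now rewrite Cmod_R.
  - unfold RtoC, Cminus, Cplus, Copp; simpl; f_equal; ring.
Qed.

Lemma ex_CRInt_vertical (f : C -> C) (a b x : R) : a <= b ->
  (forall t, a <= t <= b -> Ccont f (x, t)) -> ex_CRInt (fun t => f (x, t)) a b.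
Proof.
  intros hab H; apply ex_CRInt_cont; [exact hab|].
  intros t Ht eps heps; destruct (H t Ht eps heps) as [d [hd Hd]].
  exists d; split; [exact hd|intros u Hu; apply Hd].
  replace ((x, u) - (x, t))%C with (Ci * RtoC (u - t))%C.
  - now rewrite Cmod_mult, Cmod_Ci, Cmod_R, Rmult_1_l.
  - unfold RtoC, Ci, Cminus, Cplus, Copp, Cmult; simpl; f_equal; ring.
Qed.

Lemma CRInt_plus (f g : R -> C) (a b : R) : ex_CRInt f a b -> ex_CRInt g a b ->
  CRInt (fun t => f t + g t)%C a b = (CRInt f a b + CRInt g a b)%C.
Proof. exact (RInt_plus (V := C_R_CompleteNormedModule) f g a b). Qed.

Lemma CRInt_Chasles (f : R -> C) (a b c : R) :
  ex_CRInt f a b -> ex_CRInt f b c -> CRInt f a c = (CRInt f a b + CRInt f b c)%C.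
Proof.
  intros Hf Hg; symmetry.
  exact (RInt_Chasles (V := C_R_CompleteNormedModule) f a b c Hf Hg).
Qed.

Lemma CRInt_pair (f : R -> C) (a b u v : R) :
  is_RInt (fun t => fst (f t)) a b u -> is_RInt (fun t => snd (f t)) a b v ->
  CRInt f a b = (u, v).
Proof.
  intros Hu Hv; apply (@is_RInt_unique C_R_CompleteNormedModule f a b (u, v)).
  exact (@is_RInt_fct_extend_pair R_NormedModule R_NormedModule f a b u v Hu Hv).
Qed.

Lemma is_RInt_fst_snd (f : R -> C) (a b : R) : ex_CRInt f a b ->
  is_RInt (fun t => fst (f t)) a b (fst (CRInt f a b)) /\
  is_RInt (fun t => snd (f t)) a b (snd (CRInt f a b)).
Proof.
  intros H; pose proof (RInt_correct _ _ _ H) as H'; split.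
  - exact (@is_RInt_fct_extend_fst R_NormedModule R_NormedModule f a b _ H').
  - exact (@is_RInt_fct_extend_snd R_NormedModule R_NormedModule f a b _ H').
Qed.

(** The integral is taken in a real module, where a complex factor is not a scalar; the product is
    expanded into components. *)
Lemma CRInt_scal (c : C) (f : R -> C) (a b : R) : ex_CRInt f a b ->
  CRInt (fun t => c * f t)%C a b = (c * CRInt f a b)%C.
Proof.
  intros H; destruct (is_RInt_fst_snd H) as [H1 H2].
  apply CRInt_pair.
  - exact (is_RInt_minus _ _ _ _ _ _ (is_RInt_scal _ _ _ (fst c) _ H1)
             (is_RInt_scal _ _ _ (snd c) _ H2)).
  - exact (is_RInt_plus _ _ _ _ _ _ (is_RInt_scal _ _ _ (fst c) _ H2)
             (is_RInt_scal _ _ _ (snd c) _ H1)).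
Qed.

(** The only explicit integral of the proof: it yields [rect_int_affine] and, with slope 0, the
    comparison in [rect_int_inv_lower]. *)
Lemma is_RInt_linear (p q a b : R) :
  is_RInt (fun t => p + q * t) a b (p * (b - a) + q * (b * b - a * a) / 2).
Proof.
  replace (p * (b - a) + q * (b * b - a * a) / 2)
    with (minus (p * b + q * (b * b) / 2) (p * a + q * (a * a) / 2))
    by (unfold minus, plus, opp; simpl; field).
  apply (is_RInt_derive (fun t => p * t + q * (t * t) / 2)).
  - intros t _; auto_derive; [exact I|field].
  - intros t _; apply (ex_derive_continuous (fun u => p + q * u)).
    auto_derive; exact I.
Qed.

(** The counterclockwise contour integral: dz is dt on horizontal sides and i dt on vertical
    ones. *)
Definition rect_int (f : C -> C) (x1 x2 y1 y2 : R) : C :=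
  (CRInt (fun t => f (t, y1)) x1 x2 + Ci * CRInt (fun t => f (x2, t)) y1 y2
   - CRInt (fun t => f (t, y2)) x1 x2 - Ci * CRInt (fun t => f (x1, t)) y1 y2)%C.

Definition rect (x1 x2 y1 y2 : R) (z : C) : Prop :=
  x1 <= fst z <= x2 /\ y1 <= snd z <= y2.

Definition rect_bdry (x1 x2 y1 y2 : R) (z : C) : Prop :=
  rect x1 x2 y1 y2 z /\ (fst z = x1 \/ fst z = x2 \/ snd z = y1 \/ snd z = y2).

Lemma rect_int_bound (f : C -> C) (x1 x2 y1 y2 B : R) :
  x1 <= x2 -> y1 <= y2 ->
  (forall z, rect_bdry x1 x2 y1 y2 z -> Ccont f z /\ Cmod (f z) <= B) ->
  Cmod (rect_int f x1 x2 y1 y2) <= 2 * ((x2 - x1) + (y2 - y1)) * B.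
Proof.
  intros hx hy H.
  assert (Hh : forall y, y = y1 \/ y = y2 ->
    Cmod (CRInt (fun t => f (t, y)) x1 x2) <= (x2 - x1) * B).
  { intros y Hy.
    assert (Hb : forall t, x1 <= t <= x2 -> Ccont f (t, y) /\ Cmod (f (t, y)) <= B).
    { intros t Ht; apply H; split; [split|]; simpl; lra. }
    apply CRInt_bound; [exact hx| |].
    - apply ex_CRInt_horizontal; [exact hx|]; intros t Ht; now apply Hb.
    - intros t Ht; now apply Hb. }
  assert (Hv : forall x, x = x1 \/ x = x2 ->
    Cmod (Ci * CRInt (fun t => f (x, t)) y1 y2) <= (y2 - y1) * B).
  { intros x Hx; rewrite Cmod_mult, Cmod_Ci, Rmult_1_l.
    assert (Hb : forall t, y1 <= t <= y2 -> Ccont f (x, t) /\ Cmod (f (x, t)) <= B).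
    { intros t Ht; apply H; split; [split|]; simpl; lra. }
    apply CRInt_bound; [exact hy| |].
    - apply ex_CRInt_vertical; [exact hy|]; intros t Ht; now apply Hb.
    - intros t Ht; now apply Hb. }
  pose proof (Hh y1 (or_introl eq_refl)); pose proof (Hh y2 (or_intror eq_refl)).
  pose proof (Hv x1 (or_introl eq_refl)); pose proof (Hv x2 (or_intror eq_refl)).
  unfold rect_int.
  eapply Rle_trans; [apply Cmod_triangle_sub|].
  eapply Rle_trans; [apply Rplus_le_compat_r, Cmod_triangle_sub|].
  eapply Rle_trans; [apply Rplus_le_compat_r, Rplus_le_compat_r, Cmod_triangle|].
  lra.
Qed.

Lemma rect_int_cut_x (f : C -> C) (x1 m x2 y1 y2 : R) :
  x1 <= m <= x2 ->
  (forall t, x1 <= t <= x2 -> Ccont f (t, y1) /\ Ccont f (t, y2)) ->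
  rect_int f x1 x2 y1 y2 = (rect_int f x1 m y1 y2 + rect_int f m x2 y1 y2)%C.
Proof.
  intros hm H; unfold rect_int.
  rewrite (CRInt_Chasles (f := fun t => f (t, y1)) (b := m)),
    (CRInt_Chasles (f := fun t => f (t, y2)) (b := m)).
  1: ring.
  all: apply ex_CRInt_horizontal; [lra|intros t Ht; apply H; lra].
Qed.

Lemma rect_int_cut_y (f : C -> C) (x1 x2 y1 m y2 : R) :
  y1 <= m <= y2 ->
  (forall t, y1 <= t <= y2 -> Ccont f (x1, t) /\ Ccont f (x2, t)) ->
  rect_int f x1 x2 y1 y2 = (rect_int f x1 x2 y1 m + rect_int f x1 x2 m y2)%C.
Proof.
  intros hm H; unfold rect_int.
  rewrite (CRInt_Chasles (f := fun t => f (x1, t)) (b := m)),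
    (CRInt_Chasles (f := fun t => f (x2, t)) (b := m)).
  1: ring.
  all: apply ex_CRInt_vertical; [lra|intros t Ht; apply H; lra].
Qed.

Lemma rect_int_plus (f g : C -> C) (x1 x2 y1 y2 : R) :
  x1 <= x2 -> y1 <= y2 ->
  (forall z, rect_bdry x1 x2 y1 y2 z -> Ccont f z /\ Ccont g z) ->
  rect_int (fun z => f z + g z)%C x1 x2 y1 y2 =
  (rect_int f x1 x2 y1 y2 + rect_int g x1 x2 y1 y2)%C.
Proof.
  intros hx hy H; unfold rect_int.
  assert (Hh : forall y, y = y1 \/ y = y2 ->
    CRInt (fun t => f (t, y) + g (t, y))%C x1 x2 =
    (CRInt (fun t => f (t, y)) x1 x2 + CRInt (fun t => g (t, y)) x1 x2)%C).
  { intros y Hy; apply CRInt_plus; apply ex_CRInt_horizontal; try exact hx;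
      intros t Ht; apply H; split; [split| |split|]; simpl; lra. }
  assert (Hv : forall x, x = x1 \/ x = x2 ->
    CRInt (fun t => f (x, t) + g (x, t))%C y1 y2 =
    (CRInt (fun t => f (x, t)) y1 y2 + CRInt (fun t => g (x, t)) y1 y2)%C).
  { intros x Hx; apply CRInt_plus; apply ex_CRInt_vertical; try exact hy;
      intros t Ht; apply H; split; [split| |split|]; simpl; lra. }
  rewrite !Hh, !Hv by (now (left + right)).
  ring.
Qed.

Lemma rect_int_scal (c : C) (f : C -> C) (x1 x2 y1 y2 : R) :
  x1 <= x2 -> y1 <= y2 ->
  (forall z, rect_bdry x1 x2 y1 y2 z -> Ccont f z) ->
  rect_int (fun z => c * f z)%C x1 x2 y1 y2 = (c * rect_int f x1 x2 y1 y2)%C.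
Proof.
  intros hx hy H; unfold rect_int.
  assert (Hh : forall y, y = y1 \/ y = y2 ->
    CRInt (fun t => c * f (t, y))%C x1 x2 = (c * CRInt (fun t => f (t, y)) x1 x2)%C).
  { intros y Hy; apply (CRInt_scal c (f := fun t => f (t, y))), ex_CRInt_horizontal; try exact hx;
      intros t Ht; apply H; split; [split|]; simpl; lra. }
  assert (Hv : forall x, x = x1 \/ x = x2 ->
    CRInt (fun t => c * f (x, t))%C y1 y2 = (c * CRInt (fun t => f (x, t)) y1 y2)%C).
  { intros x Hx; apply (CRInt_scal c (f := fun t => f (x, t))), ex_CRInt_vertical; try exact hy;
      intros t Ht; apply H; split; [split|]; simpl; lra. }
  rewrite !Hh, !Hv by (now (left + right)).
  ring.
Qed.

Lemma rect_int_affine (A B : C) (x1 x2 y1 y2 : R) :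
  rect_int (fun z => A + B * z)%C x1 x2 y1 y2 = 0.
Proof.
  destruct A as [a1 a2], B as [b1 b2]; unfold rect_int.
  assert (Hh : forall y, CRInt (fun t => (a1, a2) + (b1, b2) * (t, y))%C x1 x2 =
    ((a1 - b2 * y) * (x2 - x1) + b1 * (x2 * x2 - x1 * x1) / 2,
     (a2 + b1 * y) * (x2 - x1) + b2 * (x2 * x2 - x1 * x1) / 2)).
  { intros y; apply CRInt_pair; (eapply is_RInt_ext; [|apply is_RInt_linear]);
      intros t _; simpl; ring. }
  assert (Hv : forall x, CRInt (fun t => (a1, a2) + (b1, b2) * (x, t))%C y1 y2 =
    ((a1 + b1 * x) * (y2 - y1) + (- b2) * (y2 * y2 - y1 * y1) / 2,
     (a2 + b2 * x) * (y2 - y1) + b1 * (y2 * y2 - y1 * y1) / 2)).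
  { intros x; apply CRInt_pair; (eapply is_RInt_ext; [|apply is_RInt_linear]);
      intros t _; simpl; ring. }
  rewrite !Hh, !Hv.
  apply injective_projections; simpl; field.
Qed.

(** * Goursat's theorem and the Cauchy estimate *)

Lemma nested_intervals_point (a b : nat -> R) :
  (forall n, a n <= a (S n) /\ b (S n) <= b n /\ a n <= b n) ->
  exists x, forall n, a n <= x <= b n.
Proof.
  intros H.
  assert (Hmono : forall n k, a n <= a (k + n)%nat /\ b (k + n)%nat <= b n).
  { intros n k; induction k as [|k IH]; simpl; [lra|].
    destruct (H (k + n)%nat) as [H1 [H2 _]]; lra. }
  assert (Hab : forall n m, a n <= b m).
  { intros n m; destruct (Hmono n m) as [H1 _], (Hmono m n) as [_ H2].
    replace (n + m)%nat with (m + n)%nat in H2 by lia.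
    destruct (H (m + n)%nat) as [_ [_ H3]]; lra. }
  destruct (completeness (fun r => exists n, r = a n)) as [x [Hx1 Hx2]].
  - exists (b O); intros r [n ->]; apply Hab.
  - exists (a O); now exists O.
  - exists x; intros n; split.
    + apply Hx1; now exists n.
    + apply Hx2; intros r [m ->]; apply Hab.
Qed.

Lemma exists_pow_half_lt (r eps : R) : 0 < eps -> exists n, r * (/ 2) ^ n < eps.
Proof.
  intros heps.
  destruct (pow_lt_1_zero (/ 2)) with (y := eps / (Rabs r + 1)) as [n Hn].
  - rewrite Rabs_right; lra.
  - apply Rdiv_lt_0_compat; [exact heps|]; pose proof (Rabs_pos r); lra.
  - exists n; specialize (Hn n (le_n n)).
    pose proof (Rabs_pos r) as hr.
    assert (hp : 0 < (/ 2) ^ n) by (apply pow_lt; lra).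
    rewrite Rabs_right in Hn by lra.
    apply Rlt_div_r in Hn; [|lra].
    apply Rle_lt_trans with ((/ 2) ^ n * (Rabs r + 1)); [|exact Hn].
    pose proof (Rle_abs r).
    assert (r * (/ 2) ^ n <= Rabs r * (/ 2) ^ n)
      by (apply Rmult_le_compat_r; lra); lra.
Qed.

(** Goursat's bisection as an induction principle. If [P] failed on the whole rectangle, it would
    fail on one of the quarters, and so on; the nested failures shrink to a point, where the local
    hypothesis contradicts them. *)
Lemma rect_bisection (P : R -> R -> R -> R -> Prop) (x1 x2 y1 y2 : R) :
  x1 <= x2 -> y1 <= y2 ->
  (forall a b c d, x1 <= a <= b -> b <= x2 -> y1 <= c <= d -> d <= y2 ->
     P a ((a + b) / 2) c ((c + d) / 2) -> P ((a + b) / 2) b c ((c + d) / 2) ->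
     P a ((a + b) / 2) ((c + d) / 2) d -> P ((a + b) / 2) b ((c + d) / 2) d ->
     P a b c d) ->
  (forall z, rect x1 x2 y1 y2 z -> exists delta, 0 < delta /\
     forall a b c d, x1 <= a -> b <= x2 -> y1 <= c -> d <= y2 ->
       rect a b c d z -> b - a < delta -> d - c < delta -> P a b c d) ->
  P x1 x2 y1 y2.
Proof.
  intros hx hy Hglue Hloc.
  apply NNPP; intros HP.
  set (bad := fun q : (R * R) * (R * R) =>
    (x1 <= fst (fst q) <= snd (fst q) /\ snd (fst q) <= x2) /\
    (y1 <= fst (snd q) <= snd (snd q) /\ snd (snd q) <= y2) /\
    ~ P (fst (fst q)) (snd (fst q)) (fst (snd q)) (snd (snd q))).
  assert (Hstep : forall q : sig bad, exists q' : sig bad,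
    (fst (fst (proj1_sig q)) <= fst (fst (proj1_sig q')) /\
     snd (fst (proj1_sig q')) <= snd (fst (proj1_sig q)) /\
     snd (fst (proj1_sig q')) - fst (fst (proj1_sig q')) =
       (snd (fst (proj1_sig q)) - fst (fst (proj1_sig q))) * / 2) /\
    (fst (snd (proj1_sig q)) <= fst (snd (proj1_sig q')) /\
     snd (snd (proj1_sig q')) <= snd (snd (proj1_sig q)) /\
     snd (snd (proj1_sig q')) - fst (snd (proj1_sig q')) =
       (snd (snd (proj1_sig q)) - fst (snd (proj1_sig q))) * / 2)).
  { intros [[[a b] [c d]] Hq]; simpl.
    pose proof Hq as [[Ha Hb] [[Hc Hd] Hn]]; simpl in Ha, Hb, Hc, Hd, Hn.
    assert (Hsub : exists a' b' c' d', ~ P a' b' c' d' /\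
      (a' = a /\ b' = (a + b) / 2 \/ a' = (a + b) / 2 /\ b' = b) /\
      (c' = c /\ d' = (c + d) / 2 \/ c' = (c + d) / 2 /\ d' = d)).
    { apply NNPP; intros Hno; apply Hn, Hglue; try lra;
        (apply NNPP; intros Hb'; apply Hno; do 4 eexists;
         split; [exact Hb'|tauto]). }
    destruct Hsub as [a' [b' [c' [d' [Hbad [Hab Hcd]]]]]].
    assert (Hq' : bad ((a', b'), (c', d'))).
    { split; [|split; [|exact Hbad]]; simpl; lra. }
    exists (exist _ _ Hq'); simpl; lra. }
  destruct (functional_choice _ Hstep) as [next Hnext].
  assert (H0 : bad ((x1, x2), (y1, y2))) by (split; [|split; [|exact HP]]; simpl; lra).
  set (q := fun n => Nat.iter n next (exist _ _ H0)).
  set (A := fun n => fst (fst (proj1_sig (q n)))).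
  set (B := fun n => snd (fst (proj1_sig (q n)))).
  set (C := fun n => fst (snd (proj1_sig (q n)))).
  set (D := fun n => snd (snd (proj1_sig (q n)))).
  assert (Hbad : forall n, bad ((A n, B n), (C n, D n))).
  { intros n; unfold A, B, C, D; destruct (q n) as [[[? ?] [? ?]] h]; exact h. }
  assert (HS : forall n, (A n <= A (S n) /\ B (S n) <= B n /\
      B (S n) - A (S n) = (B n - A n) * / 2) /\
    (C n <= C (S n) /\ D (S n) <= D n /\ D (S n) - C (S n) = (D n - C n) * / 2)).
  { intros n; exact (Hnext (q n)). }
  assert (Hw : forall n, B n - A n = (x2 - x1) * (/ 2) ^ n /\
                         D n - C n = (y2 - y1) * (/ 2) ^ n).
  { intros n; induction n as [|n [IH1 IH2]].
    - unfold A, B, C, D; simpl; lra.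
    - destruct (HS n) as [[_ [_ E1]] [_ [_ E2]]].
      rewrite E1, E2, IH1, IH2; simpl; lra. }
  destruct (@nested_intervals_point A B) as [u Hu].
  { intros n; destruct (HS n) as [[h1 [h2 _]] _], (Hbad n) as [[h3 _] _];
      simpl in h3; lra. }
  destruct (@nested_intervals_point C D) as [v Hv].
  { intros n; destruct (HS n) as [_ [h1 [h2 _]]], (Hbad n) as [_ [[h3 _] _]];
      simpl in h3; lra. }
  destruct (Hloc (u, v)) as [delta [hdelta Hdelta]].
  { pose proof (Hu O) as h1; pose proof (Hv O) as h2.
    unfold A, B, C, D in h1, h2; simpl in h1, h2; split; simpl; lra. }
  (* The sum dominates both side lengths, so a single [n] makes both shorter than [delta]. *)
  destruct (@exists_pow_half_lt ((x2 - x1) + (y2 - y1)) _ hdelta) as [n Hn].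
  destruct (Hbad n) as [[h1 h2] [[h3 h4] h5]]; simpl in h1, h2, h3, h4, h5.
  destruct (Hw n) as [w1 w2].
  assert (hp : 0 < (/ 2) ^ n) by (apply pow_lt; lra).
  assert (0 <= (x2 - x1) * (/ 2) ^ n) by (apply Rmult_le_pos; lra).
  assert (0 <= (y2 - y1) * (/ 2) ^ n) by (apply Rmult_le_pos; lra).
  apply h5, Hdelta; try lra.
  split; [apply Hu|apply Hv].
Qed.

Lemma Cmod_le_rect (x1 x2 y1 y2 : R) (z w : C) :
  rect x1 x2 y1 y2 z -> rect x1 x2 y1 y2 w ->
  Cmod (w - z) <= (x2 - x1) + (y2 - y1).
Proof.
  intros [Hz1 Hz2] [Hw1 Hw2].
  replace (w - z)%C with (RtoC (fst w - fst z) + Ci * RtoC (snd w - snd z))%C.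
  - eapply Rle_trans; [apply Cmod_triangle|].
    rewrite Cmod_mult, Cmod_Ci, !Cmod_R, Rmult_1_l.
    apply Rplus_le_compat; apply Rabs_le; lra.
  - apply injective_projections; simpl; ring.
Qed.

(** The bound eps times the squared sum of the side lengths survives gluing, since each quarter
    carries exactly one fourth of it. Locally the first-order expansion of [f] is subtracted, which
    costs nothing because affine functions integrate to 0. The remainder is at most eps/2 times the
    side sum, and the perimeter is twice that sum: hence the eps/2. *)
Theorem goursat (f : C -> C) (x1 x2 y1 y2 : R) :
  x1 <= x2 -> y1 <= y2 ->
  (forall z, rect x1 x2 y1 y2 z -> exists l, Cdiff f z l) ->
  rect_int f x1 x2 y1 y2 = 0.
Proof.
  intros hx hy Hf.
  assert (Hc : forall z, rect x1 x2 y1 y2 z -> Ccont f z).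
  { intros z Hz; destruct (Hf z Hz) as [l Hl]; exact (Cdiff_cont Hl). }
  assert (Hsmall : forall eps, 0 < eps -> Cmod (rect_int f x1 x2 y1 y2) <=
    eps * (((x2 - x1) + (y2 - y1)) * ((x2 - x1) + (y2 - y1)))).
  { intros eps heps.
    apply (@rect_bisection (fun a b c d => Cmod (rect_int f a b c d) <=
      eps * (((b - a) + (d - c)) * ((b - a) + (d - c))))); try assumption.
    - intros a b c d Ha Hb Hc' Hd H1 H2 H3 H4.
      rewrite (@rect_int_cut_x f a ((a + b) / 2) b c d);
        [|lra|intros t Ht; split; apply Hc; split; simpl; lra].
      rewrite (@rect_int_cut_y f a ((a + b) / 2) c ((c + d) / 2) d);
        [|lra|intros t Ht; split; apply Hc; split; simpl; lra].
      rewrite (@rect_int_cut_y f ((a + b) / 2) b c ((c + d) / 2) d);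
        [|lra|intros t Ht; split; apply Hc; split; simpl; lra].
      eapply Rle_trans; [apply Cmod_triangle|].
      eapply Rle_trans; [apply Rplus_le_compat; apply Cmod_triangle|].
      eapply Rle_trans; [apply Rplus_le_compat; apply Rplus_le_compat;
        [exact H1|exact H3|exact H2|exact H4]|].
      right; field.
    - intros z Hz; destruct (Hf z Hz) as [l Hl].
      destruct (Hl (eps / 2)) as [delta [hdelta Hdelta]]; [lra|].
      exists (delta / 2); split; [lra|].
      intros a b c d Ha Hb Hc' Hd Hzr hab hcd.
      set (A := (f z - l * z)%C).
      set (g := fun w => (f w + ((- A) + (- l) * w))%C).
      assert (hab0 : a <= b) by (destruct Hzr; lra).
      assert (hcd0 : c <= d) by (destruct Hzr; lra).
      assert (E : rect_int f a b c d = rect_int g a b c d).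
      { unfold g; rewrite rect_int_plus; try assumption.
        - rewrite rect_int_affine; ring.
        - intros w [[Hw1 Hw2] _]; split; [apply Hc; split; lra|].
          exact (Cdiff_cont (@Cdiff_affine _ _ w)). }
      rewrite E.
      replace (eps * ((b - a + (d - c)) * (b - a + (d - c)))) with
        (2 * ((b - a) + (d - c)) * (eps / 2 * ((b - a) + (d - c)))) by field.
      apply rect_int_bound; try assumption.
      intros w [Hw _]; split.
      + destruct (Hf w) as [m Hm]; [destruct Hw; split; lra|].
        apply (@Cdiff_cont g w (m + - l)%C).
        exact (Cdiff_plus Hm (Cdiff_affine (- A) (- l) w)).
      + pose proof (Cmod_le_rect Hzr Hw) as Hd1.
        unfold g, A.
        replace (f w + (- (f z - l * z) + - l * w))%C
          with (f w - f z - l * (w - z))%C by ring.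
        eapply Rle_trans; [apply Hdelta; lra|].
        apply Rmult_le_compat_l; lra. }
  apply Cmod_eq_0, Rle_antisym; [|apply Cmod_ge_0].
  apply le_epsilon; intros eps heps.
  set (s := (x2 - x1) + (y2 - y1)).
  assert (hs : 0 <= s * s) by (apply Rmult_le_pos; unfold s; lra).
  eapply Rle_trans; [apply (Hsmall (eps / (s * s + 1)))|].
  - apply Rdiv_lt_0_compat; lra.
  - fold s; rewrite Rplus_0_l.
    unfold Rdiv; rewrite Rmult_assoc.
    rewrite <- (Rmult_1_r eps) at 2; apply Rmult_le_compat_l; [lra|].
    rewrite Rmult_comm; apply Rle_div_l; lra.
Qed.

(* The frame between two concentric squares is cut into four rectangles
   avoiding the centre. *)
Lemma rect_int_shrink (f : C -> C) (a : C) (r s : R) :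
  0 < r <= s ->
  (forall z, rect (fst a - s) (fst a + s) (snd a - s) (snd a + s) z -> z <> a ->
     exists l, Cdiff f z l) ->
  rect_int f (fst a - s) (fst a + s) (snd a - s) (snd a + s) =
  rect_int f (fst a - r) (fst a + r) (snd a - r) (snd a + r).
Proof.
  destruct a as [a1 a2]; simpl; intros hrs Hf.
  assert (Hc : forall x y, a1 - s <= x <= a1 + s -> a2 - s <= y <= a2 + s ->
    x <> a1 \/ y <> a2 -> Ccont f (x, y)).
  { intros x y Hx Hy Hn; destruct (Hf (x, y)) as [l Hl].
    - split; simpl; lra.
    - intros E; injection E; lra.
    - exact (Cdiff_cont Hl). }
  assert (Hg : forall u v p q, a1 - s <= u <= v -> v <= a1 + s ->
    a2 - s <= p <= q -> q <= a2 + s -> (v < a1 \/ a1 < u \/ q < a2 \/ a2 < p) ->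
    rect_int f u v p q = 0).
  { intros u v p q Hu Hv Hp Hq Hn; apply goursat; try lra.
    intros [x y] [H1 H2]; simpl in H1, H2; apply Hf.
    - split; simpl; lra.
    - intros E; injection E; lra. }
  rewrite (@rect_int_cut_y f _ _ (a2 - s) (a2 - r) (a2 + s));
    [|lra|intros t Ht; split; apply Hc; lra].
  rewrite (@rect_int_cut_y f _ _ (a2 - r) (a2 + r) (a2 + s));
    [|lra|intros t Ht; split; apply Hc; lra].
  rewrite (@rect_int_cut_x f (a1 - s) (a1 - r) (a1 + s) (a2 - r) (a2 + r));
    [|lra|intros t Ht; split; apply Hc; lra].
  rewrite (@rect_int_cut_x f (a1 - r) (a1 + r) (a1 + s) (a2 - r) (a2 + r));
    [|lra|intros t Ht; split; apply Hc; lra].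
  rewrite (Hg (a1 - s) (a1 + s) (a2 - s) (a2 - r)) by lra.
  rewrite (Hg (a1 - s) (a1 + s) (a2 + r) (a2 + s)) by lra.
  rewrite (Hg (a1 - s) (a1 - r) (a2 - r) (a2 + r)) by lra.
  rewrite (Hg (a1 + r) (a1 + s) (a2 - r) (a2 + r)) by lra.
  ring.
Qed.

Lemma Cmod_sub_square_bdry (a : C) (s : R) (z : C) : 0 < s ->
  rect_bdry (fst a - s) (fst a + s) (snd a - s) (snd a + s) z ->
  s <= Cmod (z - a).
Proof.
  intros hs [_ H].
  eapply Rle_trans; [|apply Rmax_Cmod]; simpl.
  assert (Hs : s <= Rabs (fst z - fst a) \/ s <= Rabs (snd z - snd a)).
  { destruct H as [H|[H|[H|H]]]; rewrite H; [left|left|right|right].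
    1, 3: rewrite Rabs_left; lra.
    all: rewrite Rabs_right; lra. }
  destruct Hs as [Hs|Hs]; (eapply Rle_trans; [exact Hs|]);
    [apply Rmax_l|apply Rmax_r].
Qed.

(** The factor 2 is a crude substitute for sqrt 2, and is the origin of the radius [2 * s] in
    [cauchy_estimate]. *)
Lemma Cmod_sub_square (a : C) (s : R) (z : C) :
  rect (fst a - s) (fst a + s) (snd a - s) (snd a + s) z -> Cmod (z - a) <= 2 * s.
Proof.
  intros [H1 H2].
  replace (z - a)%C with (RtoC (fst z - fst a) + Ci * RtoC (snd z - snd a))%C.
  - eapply Rle_trans; [apply Cmod_triangle|].
    rewrite Cmod_mult, Cmod_Ci, !Cmod_R, Rmult_1_l.
    assert (Rabs (fst z - fst a) <= s) by (apply Rabs_le; lra).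
    assert (Rabs (snd z - snd a) <= s) by (apply Rabs_le; lra).
    lra.
  - apply injective_projections; simpl; ring.
Qed.

(* Each side contributes at least 1 to the imaginary part (the exact value of
   the integral is 2 pi i). *)
Lemma rect_int_inv_lower (a : C) (s : R) : 0 < s ->
  4 <= Cmod (rect_int (fun z => / (z - a))%C
               (fst a - s) (fst a + s) (snd a - s) (snd a + s)).
Proof.
  destruct a as [a1 a2]; simpl; intros hs.
  set (f := fun z : C => (/ (z - (a1, a2)))%C).
  assert (Hc : forall x y, x <> a1 \/ y <> a2 -> Ccont f (x, y)).
  { intros x y Hn; refine (Cdiff_cont (@Cdiff_inv (a1, a2) (x, y) _)).
    intros E; injection E; lra. }
  assert (Hi : forall x y, f (x, y) =
    ((x - a1) / ((x - a1) ^ 2 + (y - a2) ^ 2),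
     (a2 - y) / ((x - a1) ^ 2 + (y - a2) ^ 2))).
  { intros x y; unfold f, Cinv; simpl; f_equal; f_equal; ring. }
  assert (Hlow : forall (g : R -> R) (p I : R), is_RInt g (p - s) (p + s) I ->
    (forall t, p - s < t < p + s -> / (2 * s) <= g t) -> 1 <= I).
  { intros g p I HI Hg.
    replace 1 with (/ (2 * s) * ((p + s) - (p - s)) +
       0 * ((p + s) * (p + s) - (p - s) * (p - s)) / 2) by (field; lra).
    eapply is_RInt_le; [|apply is_RInt_linear|exact HI|]; [lra|].
    intros t Ht; specialize (Hg t Ht); lra. }
  (* On a side, |z - a|^2 = t^2 + s^2 <= 2 s^2, and the relevant component of 1/(z - a) is s / |z -
     a|^2 up to sign. Integrated over length 2 s it gives at least 1. *)
  assert (Hpt : forall t u, - s <= t <= s -> (u = s \/ u = - s) ->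
    / (2 * s) <= s / (t ^ 2 + u ^ 2)).
  { intros t u Ht Hu.
    assert (Hu2 : u ^ 2 = s ^ 2) by (destruct Hu; subst u; ring).
    rewrite Hu2.
    assert (0 < t ^ 2 + s ^ 2) by nra.
    apply Rle_div_r; [lra|].
    apply Rmult_le_reg_l with (2 * s); [lra|].
    rewrite <- Rmult_assoc, Rinv_r by lra; nra. }
  assert (Hbot : 1 <= snd (CRInt (fun t => f (t, a2 - s)) (a1 - s) (a1 + s))).
  { destruct (@is_RInt_fst_snd (fun t => f (t, a2 - s)) (a1 - s) (a1 + s)) as [_ H].
    - apply ex_CRInt_horizontal; [lra|]; intros t Ht; apply Hc; lra.
    - apply (Hlow _ _ _ H); intros t Ht; rewrite Hi; simpl snd.
      replace (a2 - (a2 - s)) with s by ring.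
      apply (Hpt (t - a1)); lra. }
  assert (Htop : snd (CRInt (fun t => f (t, a2 + s)) (a1 - s) (a1 + s)) <= - 1).
  { destruct (@is_RInt_fst_snd (fun t => f (t, a2 + s)) (a1 - s) (a1 + s)) as [_ H].
    - apply ex_CRInt_horizontal; [lra|]; intros t Ht; apply Hc; lra.
    - apply is_RInt_opp in H.
      enough (1 <= - snd (CRInt (fun t => f (t, a2 + s)) (a1 - s) (a1 + s))) by lra.
      apply (Hlow _ _ _ H); intros t Ht; rewrite Hi; simpl snd.
      eapply Rle_trans; [apply (Hpt (t - a1) (a2 + s - a2)); [lra|left; ring]|].
      right; unfold opp; simpl; unfold Rdiv; ring. }
  assert (Hright : 1 <= fst (CRInt (fun t => f (a1 + s, t)) (a2 - s) (a2 + s))).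
  { destruct (@is_RInt_fst_snd (fun t => f (a1 + s, t)) (a2 - s) (a2 + s)) as [H _].
    - apply ex_CRInt_vertical; [lra|]; intros t Ht; apply Hc; lra.
    - apply (Hlow _ _ _ H); intros t Ht; rewrite Hi; simpl fst.
      rewrite (Rplus_comm ((a1 + s - a1) ^ 2)).
      replace (a1 + s - a1) with s by ring.
      apply (Hpt (t - a2)); lra. }
  assert (Hleft : fst (CRInt (fun t => f (a1 - s, t)) (a2 - s) (a2 + s)) <= - 1).
  { destruct (@is_RInt_fst_snd (fun t => f (a1 - s, t)) (a2 - s) (a2 + s)) as [H _].
    - apply ex_CRInt_vertical; [lra|]; intros t Ht; apply Hc; lra.
    - apply is_RInt_opp in H.
      enough (1 <= - fst (CRInt (fun t => f (a1 - s, t)) (a2 - s) (a2 + s))) by lra.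
      apply (Hlow _ _ _ H); intros t Ht; rewrite Hi; simpl fst.
      rewrite (Rplus_comm ((a1 - s - a1) ^ 2)).
      eapply Rle_trans; [apply (Hpt (t - a2) (a1 - s - a1)); [lra|right; ring]|].
      right; unfold opp; simpl; unfold Rdiv; ring. }
  (* Multiplication by [Ci] moves the real parts of the vertical integrals into the imaginary part,
     and orientation turns the bounds -1 for top and left into +1. *)
  apply Rle_trans with (snd (rect_int f (a1 - s) (a1 + s) (a2 - s) (a2 + s))).
  - revert Hbot Htop Hright Hleft; unfold rect_int.
    generalize (CRInt (fun t => f (t, a2 - s)) (a1 - s) (a1 + s)),
      (CRInt (fun t => f (t, a2 + s)) (a1 - s) (a1 + s)),
      (CRInt (fun t => f (a1 + s, t)) (a2 - s) (a2 + s)),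
      (CRInt (fun t => f (a1 - s, t)) (a2 - s) (a2 + s)).
    intros I1 I2 I3 I4; simpl; lra.
  - eapply Rle_trans; [apply Rle_abs|].
    eapply Rle_trans; [apply Rmax_r|apply Rmax_Cmod].
Qed.

(** With [k] = 1/(z - a) and [g] = (F z - F a)/(z - a)^2, the singular function is [h] = [g] - l
    [k]. Its integral vanishes, so l times the integral of [k] is the integral of [g], and the two
    are compared in modulus. *)
Lemma cauchy_estimate (F : C -> C) (a l : C) (s M : R) :
  0 < s -> (forall z, Cmod (z - a) <= 2 * s -> exists m, Cdiff F z m) ->
  (forall z, Cmod (z - a) <= 2 * s -> Cmod (F z) <= M) ->
  Cdiff F a l -> Cmod l <= 4 * M / s.
Proof.
  intros hs Hd HM Hl.
  set (k := fun z => (/ (z - a))%C).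
  set (g := fun z => ((F z + (- F a + 0 * z)) * (k z * k z))%C).
  set (h := fun z => (g z + - l * k z)%C).
  set (Q := fun (u : C -> C) r =>
    rect_int u (fst a - r) (fst a + r) (snd a - r) (snd a + r)).
  assert (Hk : forall z, z <> a -> exists m, Cdiff k z m).
  { intros z Hz; eexists; apply (Cdiff_inv Hz). }
  assert (Hg : forall z, Cmod (z - a) <= 2 * s -> z <> a -> exists m, Cdiff g z m).
  { intros z Hz Hn; destruct (Hd z Hz) as [m Hm], (Hk z Hn) as [m2 Hm2].
    eexists; apply Cdiff_mult; [|exact (Cdiff_mult Hm2 Hm2)].
    exact (Cdiff_plus Hm (Cdiff_affine (- F a) 0 z)). }
  assert (Hh : forall z, Cmod (z - a) <= 2 * s -> z <> a -> exists m, Cdiff h z m).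
  { intros z Hz Hn; destruct (Hg z Hz Hn) as [m Hm], (Hk z Hn) as [m2 Hm2].
    exists (m + - l * m2)%C; exact (Cdiff_plus Hm (Cdiff_scal (- l) Hm2)). }
  assert (Hne : forall r z, 0 < r ->
    rect_bdry (fst a - r) (fst a + r) (snd a - r) (snd a + r) z ->
    (z - a)%C <> 0 /\ z <> a).
  { intros r z hr Hz.
    assert (H : (z - a)%C <> 0).
    { apply Cmod_gt_0; pose proof (Cmod_sub_square_bdry hr Hz); lra. }
    split; [exact H|intros E; apply H; rewrite E; ring]. }
  assert (Hzero : Q h s = 0).
  { apply Cmod_eq_0, Rle_antisym; [|apply Cmod_ge_0].
    apply le_epsilon; intros eps heps; rewrite Rplus_0_l.
    (* The small square has perimeter 8 r and [h] is at most (eps/8)/r on it. Its points lie within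
       2 r of [a], and r <= d/3 keeps this below [d]. *)
    destruct (Hl (eps / 8)) as [d [hd Hdl]]; [lra|].
    set (r := Rmin s (d / 3)).
    assert (hr : 0 < r) by (apply Rmin_pos; lra).
    assert (hrs : r <= s) by apply Rmin_l.
    assert (hrd : r <= d / 3) by apply Rmin_r.
    unfold Q; rewrite (@rect_int_shrink h a r s); [|lra|].
    2: { intros z Hz Hn; apply Hh; [now apply Cmod_sub_square|exact Hn]. }
    eapply Rle_trans; [apply rect_int_bound with (B := eps / 8 / r); try lra|].
    - intros z Hz.
      pose proof (Cmod_sub_square_bdry hr Hz) as Hz1.
      pose proof (Cmod_sub_square (proj1 Hz)) as Hz2.
      destruct (Hne r z hr Hz) as [Hn0 Hn].
      split.
      + destruct (Hh z) as [m Hm]; [lra|exact Hn|exact (Cdiff_cont Hm)].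
      + replace (h z) with ((F z - F a - l * (z - a)) / ((z - a) * (z - a)))%C
          by (unfold h, g, k; field; exact Hn0).
        rewrite Cmod_div, Cmod_mult by now apply Cmult_neq_0.
        specialize (Hdl z); set (u := Cmod (z - a)) in *.
        apply Rle_trans with (eps / 8 * u / (u * u)).
        * apply Rmult_le_compat_r; [|apply Hdl; lra].
          apply Rlt_le, Rinv_0_lt_compat, Rmult_lt_0_compat; lra.
        * replace (eps / 8 * u / (u * u)) with (eps / 8 * / u) by (field; lra).
          apply Rmult_le_compat_l; [lra|].
          apply Rinv_le_contravar; lra.
    - right; field; lra. }
  assert (Hsplit : Q h s = (Q g s + - l * Q k s)%C).
  { unfold Q; rewrite <- rect_int_scal; try lra.
    - unfold h; apply rect_int_plus; try lra.
      intros z Hz; destruct (Hne s z hs Hz) as [_ Hn].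
      destruct (Hk z Hn) as [m Hm].
      destruct (Hg z (Cmod_sub_square (proj1 Hz)) Hn) as [m2 Hm2].
      split; [exact (Cdiff_cont Hm2)|exact (Cdiff_cont (Cdiff_scal (- l) Hm))].
    - intros z Hz; destruct (Hk z) as [m Hm];
        [now apply (Hne s)|exact (Cdiff_cont Hm)]. }
  assert (Hgk : (l * Q k s = Q g s)%C).
  { rewrite Hzero in Hsplit.
    replace (l * Q k s)%C with (Q g s - (Q g s + - l * Q k s))%C by ring.
    rewrite <- Hsplit; ring. }
  assert (HM0 : 0 <= M).
  { eapply Rle_trans; [apply (Cmod_ge_0 (F a))|apply HM].
    replace (a - a)%C with (RtoC 0) by ring; rewrite Cmod_0; lra. }
  assert (Hgb : Cmod (Q g s) <= 16 * M / s).
  { eapply Rle_trans; [apply rect_int_bound with (B := 2 * M / (s * s)); try lra|].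
    - intros z Hz.
      pose proof (Cmod_sub_square_bdry hs Hz) as Hz1.
      pose proof (Cmod_sub_square (proj1 Hz)) as Hz2.
      destruct (Hne s z hs Hz) as [Hn0 Hn].
      split; [destruct (Hg z Hz2 Hn) as [m Hm]; exact (Cdiff_cont Hm)|].
      replace (g z) with ((F z - F a) / ((z - a) * (z - a)))%C
        by (unfold g, k; field; exact Hn0).
      rewrite Cmod_div, Cmod_mult by now apply Cmult_neq_0.
      apply Rmult_le_compat.
      + apply Cmod_ge_0.
      + apply Rlt_le, Rinv_0_lt_compat, Rmult_lt_0_compat; lra.
      + eapply Rle_trans; [apply Cmod_triangle_sub|].
        assert (Cmod (F a) <= M).
        { apply HM; replace (a - a)%C with (RtoC 0) by ring; rewrite Cmod_0; lra. }
        specialize (HM z Hz2); lra.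
      + apply Rinv_le_contravar; [now apply Rmult_lt_0_compat|].
        apply Rmult_le_compat; lra.
    - right; field; lra. }
  pose proof (rect_int_inv_lower a hs) as Hlow; fold k in Hlow.
  change (4 <= Cmod (Q k s)) in Hlow.
  rewrite <- Hgk, Cmod_mult in Hgb.
  apply Rmult_le_reg_r with 4; [lra|].
  apply Rle_trans with (Cmod l * Cmod (Q k s)).
  - apply Rmult_le_compat_l; [apply Cmod_ge_0|exact Hlow].
  - eapply Rle_trans; [exact Hgb|right; field; lra].
Qed.

(* The real mean value theorem is applied to [t => Re (conj (F b - F a) * F (a + t (b - a)))]. *)
Lemma Cdiff_mean_value (F : C -> C) (a b : C) (B : R) :
  (forall t : R, 0 <= t <= 1 ->
     exists l, Cdiff F (a + t * (b - a))%C l /\ Cmod l <= B) ->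
  Cmod (F b - F a) <= B * Cmod (b - a).
Proof.
  intros H.
  (* Choice needs a total relation; outside [0, 1] the value 0 is arbitrary. *)
  assert (H' : forall t : R, exists l, 0 <= t <= 1 ->
    Cdiff F (a + t * (b - a))%C l /\ Cmod l <= B).
  { intros t; destruct (classic (0 <= t <= 1)) as [Ht|Ht].
    - destruct (H t Ht) as [l Hl]; now exists l.
    - exists 0; tauto. }
  destruct (functional_choice _ H') as [l Hl].
  set (c := Cconj (F b - F a)).
  set (phi := fun t : R => Re (c * F (a + t * (b - a)))%C).
  destruct (@MVT_cor2 phi (fun t => Re (c * (l t * (b - a)))%C) 0 1 Rlt_0_1) as [t [Ht Ht']].
  { intros t Ht eps heps.
    destruct (Hl t Ht) as [Hd _].
    (* The added 1 keeps [K] positive when [b = a] and makes the final inequality strict through (K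
       - 1)/K < 1. *)
    set (K := Cmod c * Cmod (b - a) + 1).
    pose proof (Cmod_ge_0 c) as hc; pose proof (Cmod_ge_0 (b - a)) as hba.
    assert (hK : 0 < K).
    { unfold K; assert (0 <= Cmod c * Cmod (b - a)) by now apply Rmult_le_pos. lra. }
    destruct (Hd (eps / K)) as [d [hd Hd']]; [now apply Rdiv_lt_0_compat|].
    assert (hdel : 0 < d / (Cmod (b - a) + 1)) by (apply Rdiv_lt_0_compat; lra).
    exists (mkposreal _ hdel); intros h hn hh; simpl in hh.
    assert (hh0 : 0 < Rabs h) by now apply Rabs_pos_lt.
    set (z := (a + t * (b - a))%C) in *.
    set (y := (a + (t + h)%R * (b - a))%C).
    assert (Ey : (y - z)%C = (h * (b - a))%C).
    { unfold y, z; rewrite RtoC_plus; ring. }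
    assert (Hy : Cmod (y - z) < d).
    { rewrite Ey, Cmod_mult, Cmod_R.
      apply Rle_lt_trans with (Rabs h * (Cmod (b - a) + 1)).
      - apply Rmult_le_compat_l; lra.
      - apply Rlt_div_r in hh; lra. }
    specialize (Hd' y Hy).
    replace ((phi (t + h) - phi t) / h - Re (c * (l t * (b - a)))%C)
      with (Re (c * (F y - F z - l t * (y - z)))%C / h).
    2: { rewrite Ey; unfold phi; fold y; fold z.
         generalize (F y) (F z) (l t); intros u v w.
         unfold Re; destruct c, u, v, w, a, b; simpl; field; exact hn. }
    unfold Rdiv; rewrite Rabs_mult, Rabs_inv.
    apply Rlt_div_l; [exact hh0|].
    eapply Rle_lt_trans; [apply re_le_Cmod|].
    rewrite Cmod_mult.
    apply Rle_lt_trans with (Cmod c * (eps / K * (Rabs h * Cmod (b - a)))).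
    - apply Rmult_le_compat_l; [exact hc|].
      rewrite Ey, Cmod_mult, Cmod_R in Hd'; rewrite Ey; exact Hd'.
    - replace (Cmod c * (eps / K * (Rabs h * Cmod (b - a))))
        with (eps * Rabs h * ((K - 1) / K)) by (unfold K; field; exact (Rgt_not_eq _ _ hK)).
      rewrite <- (Rmult_1_r (eps * Rabs h)) at 2.
      apply Rmult_lt_compat_l; [now apply Rmult_lt_0_compat|].
      apply Rlt_div_l; lra. }
  destruct (Hl t) as [_ Hlt]; [lra|].
  (* The conjugate in [c] makes the increment of [phi] a squared modulus; one factor is cancelled at
     the end. *)
  assert (E : phi 1 - phi 0 = Cmod (F b - F a) * Cmod (F b - F a)).
  { unfold phi.
    replace (a + 1 * (b - a))%C with b by ring.
    replace (a + 0 * (b - a))%C with a by ring.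
    replace (Cmod (F b - F a) * Cmod (F b - F a)) with (Cmod (F b - F a) ^ 2) by ring.
    rewrite Cmod2_alt; unfold c, Re, Im.
    generalize (F b) (F a); intros [u1 u2] [v1 v2]; simpl; ring. }
  rewrite E in Ht; clear E.
  assert (Hle : Cmod (F b - F a) * Cmod (F b - F a) <=
    Cmod (F b - F a) * (B * Cmod (b - a))).
  { rewrite Ht, Rminus_0_r, Rmult_1_r.
    eapply Rle_trans; [apply Rle_abs|].
    eapply Rle_trans; [apply re_le_Cmod|].
    unfold c; rewrite !Cmod_mult, Cmod_conj.
    apply Rmult_le_compat_l; [apply Cmod_ge_0|].
    apply Rmult_le_compat_r; [apply Cmod_ge_0|exact Hlt]. }
  destruct (Rle_lt_or_eq_dec 0 (Cmod (F b - F a)) (Cmod_ge_0 _)) as [h|h].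
  - now apply Rmult_le_reg_l in Hle.
  - rewrite <- h; apply Rmult_le_pos; [|apply Cmod_ge_0].
    eapply Rle_trans; [apply Cmod_ge_0|exact Hlt].
Qed.

(** * Completeness of H^oo *)

Lemma Hinf_Cdiff (f : Hinf) (z : C) : Cmod z < 1 -> exists l, Cdiff (ext0 f) z l.
Proof.
  intros hz; destruct (Hfun_analytic f (exist _ z hz)) as [l Hl].
  exists l; now apply is_derive_Cdiff.
Qed.

Lemma Hinf_ext0_le (f : Hinf) (z : C) : Cmod z < 1 -> Cmod (ext0 f z) <= Hnorm f.
Proof. intros hz; rewrite (ext0_eq f hz); apply Hnorm_ub. Qed.

Lemma Hinf_derivative_bound (f : Hinf) (a l : C) (s : R) :
  0 < s -> Cmod a + 2 * s < 1 -> Cdiff (ext0 f) a l -> Cmod l <= 4 / s * Hnorm f.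
Proof.
  intros hs ha Hl.
  assert (Hin : forall z, Cmod (z - a) <= 2 * s -> Cmod z < 1).
  { intros z Hz; replace z with ((z - a) + a)%C by ring.
    eapply Rle_lt_trans; [apply Cmod_triangle|]; lra. }
  replace (4 / s * Hnorm f) with (4 * Hnorm f / s) by (field; lra).
  apply (cauchy_estimate (F := ext0 f) (a := a) hs); [| |exact Hl].
  - intros z Hz; apply Hinf_Cdiff, Hin, Hz.
  - intros z Hz; apply Hinf_ext0_le, Hin, Hz.
Qed.

(** Points of the segment are within [s] of [a], and the derivative bound at each needs room
    [2 * s]: together [3 * s]. *)
Lemma Hinf_lipschitz (f : Hinf) (a b : C) (s : R) :
  0 < s -> Cmod a + 3 * s < 1 -> Cmod (b - a) <= s ->
  Cmod (ext0 f b - ext0 f a) <= 4 / s * Hnorm f * Cmod (b - a).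
Proof.
  intros hs ha hb; apply Cdiff_mean_value; intros t Ht.
  set (z := (a + t * (b - a))%C).
  assert (hz : Cmod z <= Cmod a + s).
  { eapply Rle_trans; [apply Cmod_triangle|].
    apply Rplus_le_compat_l; rewrite Cmod_mult, Cmod_R, Rabs_right by lra.
    rewrite <- (Rmult_1_l s); apply Rmult_le_compat; try lra; apply Cmod_ge_0. }
  destruct (Hinf_Cdiff f (z := z)) as [l Hl]; [lra|].
  exists l; split; [exact Hl|].
  apply (Hinf_derivative_bound hs (a := z)); [lra|exact Hl].
Qed.

(** Convertible with [minus] of the module and with the difference inside [Hball], so [change] and
    [exact] pass between these forms. *)
Definition Hminus (f g : Hinf) : Hinf := Hplus f (Hopp g).

Lemma Hnorm_Hminus (f g : Hinf) : Hnorm (Hminus f g) <= Hnorm f + Hnorm g.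
Proof.
  apply Hnorm_le; intros z; simpl.
  replace (f z + RtoC (- 1) * g z)%C with (f z - g z)%C by ring.
  eapply Rle_trans; [apply Cmod_triangle_sub|].
  apply Rplus_le_compat; apply Hnorm_ub.
Qed.

Lemma ext0_Hminus (f g : Hinf) (z : C) :
  ext0 (Hminus f g) z = (ext0 f z - ext0 g z)%C.
Proof.
  unfold ext0; destruct (Rlt_dec (Cmod z) 1); simpl; ring.
Qed.

Lemma Cmod_cauchy_limit (u : nat -> C) :
  (forall eps, 0 < eps -> exists N, forall n m, (N <= n)%nat -> (N <= m)%nat ->
     Cmod (u n - u m) < eps) ->
  exists l, forall eps, 0 < eps -> exists N, forall n, (N <= n)%nat -> Cmod (u n - l) < eps.
Proof.
  intros H.
  destruct (proj1 (@filterlim_locally_cauchy nat C_R_CompleteNormedModule eventually _ u)) as [l Hl].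
  - intros eps; destruct (H eps (cond_pos eps)) as [N HN].
    exists (fun n => (N <= n)%nat); split; [now exists N|].
    intros n m Hn Hm; apply C_NormedModule_mixin_compat1.
    exact (HN m n Hm Hn).
  - exists l; intros eps heps.
    (* From boxes back to discs a factor sqrt 2 <= 2 is lost. *)
    assert (h2 : 0 < eps / 2) by lra.
    destruct (proj1 (filterlim_locally u l) Hl (mkposreal _ h2)) as [N HN].
    exists N; intros n Hn.
    pose proof (@C_NormedModule_mixin_compat2 l (u n) _ (HN n Hn)) as Hb; simpl in Hb.
    change (Cmod (u n - l) < sqrt 2 * (eps / 2)) in Hb.
    eapply Rlt_le_trans; [exact Hb|].
    assert (sqrt 2 <= 2) by (pose proof (sqrt_less 2); pose proof sqrt_pos 2; lra).
    replace eps with (2 * (eps / 2)) at 2 by field.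
    apply Rmult_le_compat_r; lra.
Qed.

Lemma Cmod_limit_le (u : nat -> C) (l : C) (B : R) (N : nat) :
  (forall eps, 0 < eps -> exists N, forall n, (N <= n)%nat -> Cmod (u n - l) < eps) ->
  (forall n, (N <= n)%nat -> Cmod (u n) <= B) -> Cmod l <= B.
Proof.
  intros Hl HB; apply le_epsilon; intros eps heps.
  destruct (Hl eps heps) as [N' HN'].
  specialize (HN' (Nat.max N N') (Nat.le_max_r _ _)).
  specialize (HB (Nat.max N N') (Nat.le_max_l _ _)).
  replace l with (u (Nat.max N N') - (u (Nat.max N N') - l))%C by ring.
  eapply Rle_trans; [apply Cmod_triangle_sub|]; lra.
Qed.

(** The limit [g] is taken on the whole plane, with the extensions by zero, so that derivatives are
    those of functions on C. At a point of the disc the derivative bound for [F n - F m] makes the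
    derivatives a Cauchy sequence, whose limit is the derivative of [g]. *)
Lemma Hinf_complete (F : nat -> Hinf) :
  (forall eps, 0 < eps -> exists N, forall n m, (N <= n)%nat -> (N <= m)%nat ->
     Hnorm (Hminus (F n) (F m)) < eps) ->
  exists G : Hinf, forall eps, 0 < eps -> exists N, forall n, (N <= n)%nat ->
     Hnorm (Hminus (F n) G) < eps.
Proof.
  intros HF.
  assert (HFz : forall z : C, forall n m,
    Cmod (ext0 (F n) z - ext0 (F m) z) <= Hnorm (Hminus (F n) (F m))).
  { intros z n m; rewrite <- ext0_Hminus.
    unfold ext0; destruct (Rlt_dec (Cmod z) 1); [apply Hnorm_ub|].
    rewrite Cmod_0; apply Hnorm_ge0. }
  assert (Hlim : forall z : C, exists l, forall eps, 0 < eps ->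
    exists N, forall n, (N <= n)%nat -> Cmod (ext0 (F n) z - l) < eps).
  { intros z; apply Cmod_cauchy_limit; intros eps heps.
    destruct (HF eps heps) as [N HN]; exists N; intros n m Hn Hm.
    eapply Rle_lt_trans; [apply HFz|now apply HN]. }
  destruct (functional_choice _ Hlim) as [g Hg].
  assert (Hunif : forall eps, 0 < eps -> exists N, forall n, (N <= n)%nat ->
    forall z, Cmod (ext0 (F n) z - g z) <= eps).
  { intros eps heps; destruct (HF eps heps) as [N HN].
    exists N; intros n Hn z.
    apply (@Cmod_limit_le (fun m => ext0 (F n) z - ext0 (F m) z)%C _ _ N).
    - intros e he; destruct (Hg z e he) as [N' HN']; exists N'; intros m Hm.
      replace (ext0 (F n) z - ext0 (F m) z - (ext0 (F n) z - g z))%C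
        with (- (ext0 (F m) z - g z))%C by ring.
      rewrite Cmod_opp; now apply HN'.
    - intros m Hm; eapply Rle_trans; [apply HFz|apply Rlt_le; now apply HN]. }
  assert (Han : analytic (fun z : Defs.disc => g z)).
  { apply (@analytic_ext_loc _ g); [reflexivity|]; intros [a ha]; simpl.
    set (s := (1 - Cmod a) / 4).
    assert (hs : 0 < s) by (unfold s; lra).
    assert (has : Cmod a + 3 * s < 1) by (unfold s; lra).
    assert (Hd : forall n, exists l, Cdiff (ext0 (F n)) a l)
      by (intros n; now apply Hinf_Cdiff).
    destruct (functional_choice _ Hd) as [d Hdn].
    assert (Hdd : forall n m,
      Cmod (d n - d m) <= 4 / s * Hnorm (Hminus (F n) (F m))).
    { intros n m; apply (@Hinf_derivative_bound _ a _ s hs); [lra|].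
      apply (@Cdiff_ext (fun z => ext0 (F n) z + (RtoC (- 1)) * ext0 (F m) z)%C).
      - intros z; rewrite ext0_Hminus; ring.
      - replace (d n - d m)%C with (d n + RtoC (- 1) * d m)%C by ring.
        exact (Cdiff_plus (Hdn n) (Cdiff_scal (- 1) (Hdn m))). }
    destruct (@Cmod_cauchy_limit d) as [l Hl].
    { intros eps heps.
      destruct (HF (eps / (4 / s))) as [N HN].
      { apply Rdiv_lt_0_compat; [exact heps|apply Rdiv_lt_0_compat; lra]. }
      exists N; intros n m Hn Hm; eapply Rle_lt_trans; [apply Hdd|].
      rewrite Rmult_comm; apply Rlt_div_r; [apply Rdiv_lt_0_compat; lra|].
      now apply HN. }
    exists l; apply is_derive_Cdiff; intros eps heps.
    destruct (HF (eps / 3 / (4 / s))) as [N1 HN1].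
    { apply Rdiv_lt_0_compat; [lra|apply Rdiv_lt_0_compat; lra]. }
    destruct (Hl (eps / 3)) as [N2 HN2]; [lra|].
    set (N := Nat.max N1 N2).
    destruct (Hdn N (eps / 3)) as [del [hdel Hdel]]; [lra|].
    exists (Rmin del s); split; [now apply Rmin_pos|intros y Hy].
    pose proof (Rlt_le_trans _ _ _ Hy (Rmin_l _ _)) as Hy1.
    pose proof (Rlt_le_trans _ _ _ Hy (Rmin_r _ _)) as Hy2.
    (* The Lipschitz bound for [F m - F N] holds uniformly in m >= N1, so it passes to the limit
       [g - F N]. *)
    assert (H1 : Cmod ((g y - g a) - (ext0 (F N) y - ext0 (F N) a))
                 <= eps / 3 * Cmod (y - a)).
    { apply (@Cmod_limit_le (fun m =>
        (ext0 (F m) y - ext0 (F m) a) - (ext0 (F N) y - ext0 (F N) a))%C _ _ N1).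
      - intros e he.
        destruct (Hg y (e / 2)) as [M1 HM1]; [lra|].
        destruct (Hg a (e / 2)) as [M2 HM2]; [lra|].
        exists (Nat.max M1 M2); intros m Hm.
        specialize (HM1 m ltac:(lia)); specialize (HM2 m ltac:(lia)).
        replace (ext0 (F m) y - ext0 (F m) a - (ext0 (F N) y - ext0 (F N) a)
          - (g y - g a - (ext0 (F N) y - ext0 (F N) a)))%C
          with ((ext0 (F m) y - g y) - (ext0 (F m) a - g a))%C by ring.
        eapply Rle_lt_trans; [apply Cmod_triangle_sub|]; lra.
      - intros m Hm.
        replace (ext0 (F m) y - ext0 (F m) a - (ext0 (F N) y - ext0 (F N) a))%C
          with (ext0 (Hminus (F m) (F N)) y - ext0 (Hminus (F m) (F N)) a)%C
          by (rewrite !ext0_Hminus; ring).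
        eapply Rle_trans; [apply (Hinf_lipschitz _ hs has); lra|].
        apply Rmult_le_compat_r; [apply Cmod_ge_0|].
        apply Rlt_le; rewrite Rmult_comm.
        apply Rlt_div_r; [apply Rdiv_lt_0_compat; lra|].
        apply HN1; [exact Hm|unfold N; lia]. }
    specialize (Hdel y Hy1).
    specialize (HN2 N ltac:(unfold N; lia)).
    (* Three errors of eps/3 each: replacing [g] by [F N], differentiability of [F N], replacing
       [d N] by [l]. *)
    replace (g y - g a - l * (y - a))%C with
      (((g y - g a) - (ext0 (F N) y - ext0 (F N) a))
       + (ext0 (F N) y - ext0 (F N) a - d N * (y - a))
       + (d N - l) * (y - a))%C by ring.
    eapply Rle_trans; [apply Cmod_triangle|].
    eapply Rle_trans; [apply Rplus_le_compat_r, Cmod_triangle|].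
    rewrite Cmod_mult.
    assert (Cmod (d N - l) * Cmod (y - a) <= eps / 3 * Cmod (y - a))
      by (apply Rmult_le_compat_r; [apply Cmod_ge_0|lra]).
    lra. }
  assert (Hbd : Defs.bounded (fun z : Defs.disc => g z)).
  { destruct (Hunif 1 Rlt_0_1) as [N HN]; exists (1 + Hnorm (F N)); intros z.
    specialize (HN N (le_n N) z); rewrite ext0_in in HN.
    replace (g z) with (- (F N z - g z) + F N z)%C by ring.
    eapply Rle_trans; [apply Cmod_triangle|]; rewrite Cmod_opp.
    pose proof (Hnorm_ub (F N) z); lra. }
  exists (mkHinf Han Hbd); intros eps heps.
  destruct (Hunif (eps / 2)) as [N HN]; [lra|].
  exists N; intros n Hn; apply Rle_lt_trans with (eps / 2); [|lra].
  apply Hnorm_le; intros z; simpl.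
  specialize (HN n Hn z); rewrite ext0_in in HN.
  replace (F n z + RtoC (- 1) * g z)%C with (F n z - g z)%C by ring; exact HN.
Qed.

(** * Baire category *)

Definition seq_complete (X : UniformSpace) : Prop :=
  forall u : nat -> X,
    (forall eps : posreal, exists N, forall n m, (N <= n)%nat -> (N <= m)%nat ->
       ball (u n) eps (u m)) ->
    exists x, forall eps : posreal, exists N, forall n, (N <= n)%nat -> ball x eps (u n).

(** The doubled ball has to avoid [A]: a limit of points in the ball of radius [s] may leave that
    ball, but stays in the doubled one. *)
Lemma nowhere_dense_escape (X : UniformSpace) (A : X -> Prop) (x : X) (r : posreal) :
  nowhere_dense A -> forall e : posreal, exists (y : X) (s : posreal), s < e /\
    forall z, ball y (2 * s) z -> ball x r z /\ ~ A z.
Proof.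
  intros HA e.
  assert (H : exists y, ball x (r / 2) y /\ ~ closure A y).
  { apply NNPP; intros Hn.
    assert (hr : 0 < r / 2) by (pose proof (cond_pos r); lra).
    apply (HA x); exists (mkposreal _ hr); intros y Hy.
    apply NNPP; intros Hc; apply Hn; now exists y. }
  destruct H as [y [Hy Hc]].
  assert (HU : exists U, locally y U /\ forall z, U z -> ~ A z).
  { apply NNPP; intros Hn; apply Hc; intros U HU.
    apply NNPP; intros Hz; apply Hn; exists U; split; [exact HU|].
    intros z Hz1 Hz2; apply Hz; now exists z. }
  destruct HU as [U [[d Hd] HU]].
  (* These make 2 s <= d, r/2 + 2 s <= r and s < e. *)
  assert (hs : 0 < Rmin (Rmin (d / 2) (r / 4)) (e / 2)).
  { pose proof (cond_pos d); pose proof (cond_pos r); pose proof (cond_pos e).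
    repeat apply Rmin_pos; lra. }
  exists y, (mkposreal _ hs); simpl; set (s := Rmin _ (e / 2)).
  assert (s <= e / 2) by apply Rmin_r.
  assert (s <= Rmin (d / 2) (r / 4)) by apply Rmin_l.
  pose proof (Rmin_l (d / 2) (r / 4)); pose proof (Rmin_r (d / 2) (r / 4)).
  split; [pose proof (cond_pos e); lra|intros z Hz; split].
  - apply ball_le with (r / 2 + 2 * s); [lra|].
    apply ball_triangle with y; [exact Hy|exact Hz].
  - apply HU, Hd; apply ball_le with (2 * s); [lra|exact Hz].
Qed.

Theorem baire (X : UniformSpace) (x0 : X) :
  seq_complete X -> ~ meager (fun _ : X => True).
Proof.
  intros HX [N [HN Hcov]].
  assert (Hstep : forall p : (X * posreal) * nat, exists q : X * posreal,
    snd q < / (INR (snd p) + 1) /\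
    forall z, ball (fst q) (2 * snd q) z ->
      ball (fst (fst p)) (snd (fst p)) z /\ ~ N (snd p) z).
  { intros [[x r] k]; simpl.
    assert (he : 0 < / (INR k + 1)).
    { apply Rinv_0_lt_compat; pose proof (pos_INR k); lra. }
    destruct (nowhere_dense_escape x r (HN k) (mkposreal _ he)) as [y [s Hs]].
    now exists (y, s). }
  destruct (functional_choice _ Hstep) as [next Hnext].
  set (p := fix p n := match n with
    | O => (x0, mkposreal 1 Rlt_0_1)
    | S m => next (p m, m) end).
  assert (Hp : forall n, snd (p (S n)) < / (INR n + 1) /\
    forall z, ball (fst (p (S n))) (2 * snd (p (S n))) z ->
      ball (fst (p n)) (snd (p n)) z /\ ~ N n z).
  { intros n; exact (Hnext (p n, n)). }
  assert (Hball : forall n k z, ball (fst (p (k + n)%nat)) (snd (p (k + n)%nat)) z ->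
    ball (fst (p n)) (snd (p n)) z).
  { intros n k; induction k as [|k IH]; intros z Hz; [exact Hz|].
    apply IH, (proj2 (Hp (k + n)%nat)).
    change (S k + n)%nat with (S (k + n)) in Hz.
    apply (ball_le (fst (p (S (k + n))))) with (2 := Hz).
    pose proof (cond_pos (snd (p (S (k + n))))); lra. }
  assert (Hin : forall n m, (n <= m)%nat -> ball (fst (p n)) (snd (p n)) (fst (p m))).
  { intros n m Hnm; replace m with ((m - n) + n)%nat by lia.
    apply Hball with (m - n)%nat, ball_center. }
  destruct (HX (fun n => fst (p n))) as [x Hx].
  - intros eps.
    (* Then 1/(k + 1) < eps/2, and two later centres are each within eps/2 of the centre numbered k
       + 1. *)
    destruct (nfloor_ex (2 / eps)) as [k [_ Hk]].
    { apply Rlt_le, Rdiv_lt_0_compat; [lra|apply cond_pos]. }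
    assert (Hr : snd (p (S k)) < eps / 2).
    { eapply Rlt_trans; [apply Hp|].
      pose proof (cond_pos eps) as heps.
      replace (eps / 2) with (/ (2 / eps)) by (field; lra).
      apply Rinv_lt_contravar; [|exact Hk].
      apply Rmult_lt_0_compat; [apply Rdiv_lt_0_compat; lra|pose proof (pos_INR k); lra]. }
    exists (S k); intros n m Hn Hm.
    apply ball_le with (snd (p (S k)) + snd (p (S k))); [lra|].
    apply ball_triangle with (fst (p (S k))); [apply ball_sym|]; now apply Hin.
  - destruct (Hcov x I) as [k Hk].
    refine (proj2 (proj2 (Hp k) x _) Hk).
    destruct (Hx (snd (p (S k)))) as [M HM].
    (* One radius from the centre to a late term of the sequence, one from that term to the
       limit. *)
    replace (2 * snd (p (S k))) with (snd (p (S k)) + snd (p (S k))) by ring.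
    apply ball_triangle with (fst (p (Nat.max M (S k)))).
    + apply Hin; lia.
    + apply ball_sym, HM; lia.
Qed.

Lemma Hinf_seq_complete : seq_complete Hinf_UniformSpace.
Proof.
  intros u Hu.
  destruct (@Hinf_complete u) as [G HG].
  - intros eps heps; destruct (Hu (mkposreal _ heps)) as [N HN].
    exists N; intros n m Hn Hm; exact (HN m n Hm Hn).
  - exists G; intros eps; destruct (HG eps (cond_pos eps)) as [N HN].
    exists N; exact HN.
Qed.

Lemma R_seq_complete : seq_complete R_UniformSpace.
Proof.
  intros u Hu.
  destruct (proj1 (@filterlim_locally_cauchy nat R_CompleteSpace eventually _ u)) as [l Hl].
  - intros eps; destruct (Hu eps) as [N HN].
    exists (fun n => (N <= n)%nat); split; [now exists N|].
    intros n m Hn Hm; now apply HN.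
  - exists l; intros eps.
    destruct (proj1 (filterlim_locally u l) Hl eps) as [N HN]; now exists N.
Qed.

(** If the closure contained a ball of radius e about x, the only point of [A] would be within e/4
    of both x and x + e/2. *)
Lemma nowhere_dense_subsingleton (A : R -> Prop) :
  (forall x y, A x -> A y -> x = y) -> nowhere_dense (X := R_UniformSpace) A.
Proof.
  intros HA x [e He].
  pose proof (cond_pos e) as he.
  assert (H : forall y, Rabs (y - x) < e -> exists z, Rabs (z - y) < e / 4 /\ A z).
  { intros y Hy; apply (He y Hy).
    assert (h4 : 0 < e / 4) by lra.
    exists (mkposreal _ h4); intros z Hz; exact Hz. }
  destruct (H x) as [z [Hz Az]]; [rewrite Rminus_diag, Rabs_R0; lra|].
  destruct (H (x + e / 2)) as [z' [Hz' Az']].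
  { replace (x + e / 2 - x) with (e / 2) by ring; rewrite Rabs_right; lra. }
  rewrite (HA z' z Az' Az) in Hz'.
  apply Rabs_def2 in Hz; apply Rabs_def2 in Hz'; lra.
Qed.

(** The fibres of an injection would cover the line by countably many nowhere dense sets. This is
    uncountability in the form of [countable_set]. *)
Lemma R_no_injection_nat (h : R -> nat) : ~ (forall x y, h x = h y -> x = y).
Proof.
  intros Hinj; apply (@baire R_UniformSpace 0 R_seq_complete).
  exists (fun k x => h x = k); split.
  - intros k; apply nowhere_dense_subsingleton.
    intros x y Hx Hy; apply Hinj; congruence.
  - intros x _; now exists (h x).
Qed.

(** * Orbits of weighted composition operators *)

Lemma LimInf_seq_0_iff (u : nat -> R) : (forall n, 0 <= u n) ->
  LimInf_seq u = Finite 0 <->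
  forall eps, 0 < eps -> forall N, exists n, (N <= n)%nat /\ u n < eps.
Proof.
  intros Hu; split; intros H.
  - destruct (ex_LimInf_seq u) as [l Hl].
    rewrite (is_LimInf_seq_unique _ _ Hl) in H; subst l.
    intros eps heps N; destruct (Hl (mkposreal _ heps)) as [H1 _].
    destruct (H1 N) as [n Hn]; exists n; simpl in Hn; now rewrite Rplus_0_l in Hn.
  - apply is_LimInf_seq_unique; intros eps; split.
    + intros N; rewrite Rplus_0_l; exact (H eps (cond_pos eps) N).
    + exists O; intros n _; pose proof (Hu n); pose proof (cond_pos eps); lra.
Qed.

Lemma LimSup_seq_p_infty_iff (u : nat -> R) :
  LimSup_seq u = p_infty <-> forall M, exists n, M < u n.
Proof.
  split; intros H.
  - destruct (ex_LimSup_seq u) as [l Hl].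
    rewrite (is_LimSup_seq_unique _ _ Hl) in H; subst l.
    intros M; destruct (Hl M O) as [n [_ Hn]]; now exists n.
  - apply is_LimSup_seq_unique; intros M N.
    (* A term that also exceeds the first [N] terms must occur past them. *)
    assert (Hmax : exists M', M <= M' /\ forall k, (k < N)%nat -> u k <= M').
    { induction N as [|N [M' [H1 H2]]].
      - exists M; split; [lra|intros k Hk; lia].
      - exists (Rmax M' (u N)); split.
        + eapply Rle_trans; [exact H1|apply Rmax_l].
        + intros k Hk; destruct (Nat.eq_dec k N) as [->|Hn]; [apply Rmax_r|].
          eapply Rle_trans; [apply H2; lia|apply Rmax_l]. }
    destruct Hmax as [M' [H1 H2]]; destruct (H M') as [n Hn].
    exists n; split; [|lra].
    destruct (Compare_dec.le_lt_dec N n) as [h|h]; [exact h|].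
    specialize (H2 n h); lra.
Qed.

Lemma Hnorm_iter_wcomp_le (w : Hinf) (phi : analytic_self_map) (n : nat) (f : Hinf) :
  Hnorm (Nat.iter n (wcomp w phi) f) <= Hnorm (wprod w phi n) * Hnorm f.
Proof.
  rewrite wcomp_iter; eapply Rle_trans; [apply Hnorm_mult|].
  apply Rmult_le_compat_l; [apply Hnorm_ge0|].
  apply Hnorm_le; intros z; exact (Hnorm_ub f (asm_iter phi n z)).
Qed.

Lemma iter_wcomp_Hminus (w : Hinf) (phi : analytic_self_map) (n : nat) (f g : Hinf) :
  Hminus (Nat.iter n (wcomp w phi) f) (Nat.iter n (wcomp w phi) g) =
  Nat.iter n (wcomp w phi) (Hminus f g).
Proof. rewrite !wcomp_iter; apply Hinf_ext; intros z; simpl; ring. Qed.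

(** Composition fixes constants. This exact value is the source of all lower bounds on orbits: for
    the operator norm, for nowhere density and for the scrambled set. *)
Lemma Hnorm_iter_wcomp_const (w : Hinf) (phi : analytic_self_map) (n : nat) (c : C) :
  Hnorm (Nat.iter n (wcomp w phi) (Hconst c)) = Cmod c * Hnorm (wprod w phi n).
Proof.
  apply Rle_antisym.
  - rewrite wcomp_iter; apply Hnorm_le; intros z; simpl.
    rewrite Cmod_mult, Rmult_comm; apply Rmult_le_compat_l; [apply Cmod_ge_0|].
    apply Hnorm_ub.
  - destruct (Req_dec (Cmod c) 0) as [h|h].
    + rewrite h, Rmult_0_l; apply Hnorm_ge0.
    + pose proof (Cmod_ge_0 c) as hc.
      rewrite Rmult_comm; apply Rle_div_r; [lra|].
      apply Hnorm_le; intros z; apply Rle_div_r; [lra|].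
      rewrite <- Cmod_mult; rewrite wcomp_iter.
      exact (Hnorm_ub (Hmult (wprod w phi n) (Hcomp (Hconst c) (asm_iter phi n))) z).
Qed.

Lemma Hnorm_iter_wcomp_one (w : Hinf) (phi : analytic_self_map) (n : nat) :
  Hnorm (Nat.iter n (wcomp w phi) (Hconst 1)) = Hnorm (wprod w phi n).
Proof. now rewrite Hnorm_iter_wcomp_const, Cmod_1, Rmult_1_l. Qed.

Lemma power_bounded_wcomp (w : Hinf) (phi : analytic_self_map) :
  power_bounded (wcomp w phi) <-> exists M, forall n, Hnorm (wprod w phi n) <= M.
Proof.
  unfold power_bounded; set (T := wcomp w phi).
  assert (H1 : Hnorm (Hconst 1) <= 1)
    by (apply Hnorm_le; intros z; simpl; rewrite Cmod_1; lra).
  split.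
  - intros H.
    assert (Hle : forall n, Rbar_le (Hnorm (wprod w phi (S n)))
      (Sup_seq (fun n => op_norm (Nat.iter (S n) T)))).
    { intros n; apply Sup_seq_minor_le with n.
      apply (proj1 (Lub_Rbar_correct _)).
      exists (Hconst 1); split; [exact H1|].
      symmetry; exact (Hnorm_iter_wcomp_one w phi (S n)). }
    destruct (Sup_seq _) as [M| |]; [|contradiction|exfalso; exact (Hle O)].
    (* Index 0 is outside the supremum; there the empty product has norm at most 1. *)
    exists (Rmax 1 M); intros [|n].
    + eapply Rle_trans; [exact H1|apply Rmax_l].
    + eapply Rle_trans; [exact (Hle n)|apply Rmax_r].
  - intros [M HM].
    apply Rbar_le_lt_trans with (Finite M); [|exact I].
    apply Rbar_not_lt_le; intros Hlt; apply Sup_seq_minor_lt in Hlt as [n Hn].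
    apply (Rbar_lt_not_le _ _ Hn), (proj2 (Lub_Rbar_correct _)).
    intros r [f [Hf ->]]; simpl Rbar_le.
    eapply Rle_trans; [exact (Hnorm_iter_wcomp_le w phi (S n) f)|].
    rewrite <- (Rmult_1_r M); apply Rmult_le_compat;
      [apply Hnorm_ge0|apply Hnorm_ge0|apply HM|exact Hf].
Qed.

(** When the norms are bounded, one small [wprod w phi N] thereby makes all later ones small. *)
Lemma wprod_add_le (w : Hinf) (phi : analytic_self_map) (m n : nat) :
  Hnorm (wprod w phi (m + n)) <= Hnorm (wprod w phi m) * Hnorm (wprod w phi n).
Proof.
  rewrite <- (Hnorm_iter_wcomp_one w phi (m + n)), <- (Hnorm_iter_wcomp_one w phi n), Nat.iter_add.
  apply Hnorm_iter_wcomp_le.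
Qed.

(** If the closure contains the ball of radius e about [f], then [f] and [f] + e/2 both have orbits
    bounded by [k]. Their difference is the constant e/2, so (e/2) ||w^(n)|| <= 2 k for all n.
    Constant perturbations suffice since T^n attains its norm at 1. *)
Lemma nowhere_dense_bounded_orbit (w : Hinf) (phi : analytic_self_map) (k : R) :
  ~ (exists M, forall n, Hnorm (wprod w phi n) <= M) ->
  nowhere_dense (X := Hinf_UniformSpace)
    (fun f => forall n, Hnorm (Nat.iter n (wcomp w phi) f) <= k).
Proof.
  intros Hub f [e He]; apply Hub.
  pose proof (cond_pos e) as he.
  (* The set is closed, each iterate being continuous. *)
  assert (Hcl : forall g, Hnorm (Hminus g f) < e ->
    forall n, Hnorm (Nat.iter n (wcomp w phi) g) <= k).
  { intros g Hg n; apply le_epsilon; intros eps heps.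
    set (A := Hnorm (wprod w phi n)).
    assert (hA : 0 <= A) by apply Hnorm_ge0.
    assert (hd : 0 < eps / (A + 1)) by (apply Rdiv_lt_0_compat; lra).
    destruct (He g Hg (fun h => Hnorm (Hminus h g) < eps / (A + 1))) as [h [Hh Hhk]].
    { exists (mkposreal _ hd); intros h Hh; exact Hh. }
    replace g with (Hminus h (Hminus h g))
      by (apply Hinf_ext; intros z; simpl; ring).
    rewrite <- iter_wcomp_Hminus; eapply Rle_trans; [apply Hnorm_Hminus|].
    apply Rplus_le_compat; [apply Hhk|].
    eapply Rle_trans; [apply Hnorm_iter_wcomp_le|]; fold A.
    apply Rlt_div_r in Hh; [|lra].
    pose proof (Hnorm_ge0 (Hminus h g)); nra. }
  exists (2 * (2 * k / e)); intros n.
  set (c := e / 2).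
  assert (hc : 0 < c) by (unfold c; lra).
  assert (Hf : Hnorm (Nat.iter n (wcomp w phi) f) <= k).
  { apply Hcl; eapply Rle_lt_trans; [apply (@Hnorm_le _ 0)|exact he].
    intros z; simpl; replace (f z + RtoC (- 1) * f z)%C with (RtoC 0) by ring.
    rewrite Cmod_0; lra. }
  assert (Hfc : Hnorm (Nat.iter n (wcomp w phi) (Hplus f (Hconst c))) <= k).
  { apply Hcl; apply Rle_lt_trans with c; [apply Hnorm_le|unfold c; lra].
    intros z; simpl; replace (f z + c + RtoC (- 1) * f z)%C with (RtoC c) by ring.
    rewrite Cmod_R, Rabs_right; lra. }
  pose proof (Hnorm_iter_wcomp_const w phi n c) as E.
  rewrite Cmod_R, Rabs_right in E by lra.
  replace (Hconst c) with (Hminus (Hplus f (Hconst c)) f) in E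
    by (apply Hinf_ext; intros z; simpl; ring).
  rewrite <- iter_wcomp_Hminus in E.
  assert (Hs : c * Hnorm (wprod w phi n) <= k + k).
  { rewrite <- E; eapply Rle_trans; [apply Hnorm_Hminus|].
    now apply Rplus_le_compat. }
  replace (2 * (2 * k / e)) with ((k + k) / c) by (unfold c; field; lra).
  apply Rle_div_r; lra.
Qed.

Theorem theorem6 (phi : analytic_self_map) (w : Hinf)
  (hw : LimInf_seq (fun n : nat => norm (wprod w phi n)) = Finite 0%R) :
  (li_yorke_chaotic (wcomp w phi) <-> residual (irregular (wcomp w phi))) /\
  (residual (irregular (wcomp w phi)) <-> ~ power_bounded (wcomp w phi)).
Proof.
  rewrite power_bounded_wcomp.
  change (LimInf_seq (fun n => Hnorm (wprod w phi n)) = Finite 0) in hw.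
  rewrite LimInf_seq_0_iff in hw by (intros n; apply Hnorm_ge0).
  set (pb := exists M, forall n, Hnorm (wprod w phi n) <= M).
  assert (Hinf0 : forall f, LimInf_seq (fun n => Hnorm (Nat.iter n (wcomp w phi) f)) = Finite 0).
  { intros f; apply LimInf_seq_0_iff; [intros n; apply Hnorm_ge0|].
    intros eps heps N; pose proof (Hnorm_ge0 f) as hf.
    destruct (hw (eps / (Hnorm f + 1))) with (N := N) as [n [Hn Hlt]];
      [apply Rdiv_lt_0_compat; lra|].
    exists n; split; [exact Hn|].
    eapply Rle_lt_trans; [apply Hnorm_iter_wcomp_le|].
    apply Rlt_div_r in Hlt; [|lra].
    pose proof (Hnorm_ge0 (wprod w phi n)); nra. }
  assert (Hzero : pb -> forall f eps, 0 < eps -> exists N, forall n, (N <= n)%nat ->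
    Hnorm (Nat.iter n (wcomp w phi) f) < eps).
  { intros [M HM] f eps heps.
    assert (hM : 0 <= M) by (eapply Rle_trans; [apply Hnorm_ge0|apply (HM O)]).
    pose proof (Hnorm_ge0 f) as hf.
    assert (hK : 0 < M * Hnorm f + 1)
      by (pose proof (Rmult_le_pos _ _ hM hf); lra).
    destruct (hw (eps / (M * Hnorm f + 1))) with (N := O) as [N [_ HN]];
      [now apply Rdiv_lt_0_compat|].
    exists N; intros n Hn; replace n with ((n - N) + N)%nat by lia.
    eapply Rle_lt_trans; [apply Hnorm_iter_wcomp_le|].
    apply Rlt_div_r in HN; [|exact hK].
    pose proof (Hnorm_ge0 (wprod w phi N)) as hN.
    eapply Rle_lt_trans; [apply Rmult_le_compat_r;
      [exact hf|eapply Rle_trans;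
        [apply wprod_add_le|apply Rmult_le_compat_r; [exact hN|apply HM]]]|].
    nra. }
  assert (Hub : ~ pb -> forall M, exists n, M < Hnorm (wprod w phi n)).
  { intros Hn M; apply NNPP; intros H; apply Hn; exists M; intros n.
    apply Rnot_lt_le; intros Hlt; apply H; now exists n. }
  assert (H13 : li_yorke_chaotic (wcomp w phi) -> ~ pb).
  (* No two distinct points of [S] can satisfy the upper limit condition, so [S] has at most one
     point and any map is injective on it. *)
  { intros [S [Hunc HS]] Hpb; apply Hunc; exists (fun _ => O).
    intros x y Hx Hy _; apply NNPP; intros Hxy.
    destruct (HS x y Hx Hy Hxy) as [_ Hsup].
    set (u := fun n => Hnorm (Hminus (Nat.iter n (wcomp w phi) x)
      (Nat.iter n (wcomp w phi) y))).
    change (Rbar_lt 0 (LimSup_seq u)) in Hsup.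
    rewrite (is_LimSup_seq_unique u (Finite 0)) in Hsup; [simpl in Hsup; lra|].
    intros eps; split.
    - intros N; exists N; split; [lia|].
      apply Rlt_le_trans with 0; [pose proof (cond_pos eps); lra|apply Hnorm_ge0].
    - destruct (Hzero Hpb (Hminus x y) eps (cond_pos eps)) as [N HN].
      exists N; intros n Hn; rewrite Rplus_0_l; unfold u.
      rewrite iter_wcomp_Hminus; now apply HN. }
  assert (H32 : ~ pb -> residual (irregular (wcomp w phi))).
  { intros Hn; exists (fun k f => forall n, Hnorm (Nat.iter n (wcomp w phi) f) <= INR k).
    split; [intros k; now apply nowhere_dense_bounded_orbit|].
    intros f Hf; apply NNPP; intros Hk; apply Hf; split; [apply Hinf0|].
    apply LimSup_seq_p_infty_iff; intros M; apply NNPP; intros HM; apply Hk.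
    destruct (INR_unbounded M) as [k hk]; exists k; intros n.
    apply Rnot_lt_le; intros Hlt; apply HM; exists n.
    change (M < Hnorm (Nat.iter n (wcomp w phi) f)); lra. }
  assert (H23 : residual (irregular (wcomp w phi)) -> ~ pb).
  { intros Hres Hpb.
    (* Bounded powers leave no irregular vector, so the complement, which is the whole space, would
       be meager. *)
    apply (@baire Hinf_UniformSpace (Hconst 0) Hinf_seq_complete).
    destruct Hres as [N [HN Hcov]]; exists N; split; [exact HN|].
    intros f _; apply Hcov; intros [_ Hsup].
    rewrite LimSup_seq_p_infty_iff in Hsup.
    destruct Hpb as [M HM]; destruct (Hsup (M * Hnorm f)) as [n Hn].
    change (M * Hnorm f < Hnorm (Nat.iter n (wcomp w phi) f)) in Hn.
    apply (Rlt_irrefl (M * Hnorm f)); eapply Rlt_le_trans; [exact Hn|].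
    eapply Rle_trans; [apply Hnorm_iter_wcomp_le|].
    apply Rmult_le_compat_r; [apply Hnorm_ge0|apply HM]. }
  assert (H31 : ~ pb -> li_yorke_chaotic (wcomp w phi)).
  (* Differences of distinct real constants are nonzero constants, so a pair reduces to a single
     orbit of norm |x - y| ||w^(n)||. *)
  { intros Hn; exists (fun f => exists r : R, f = Hconst r); split.
    - intros [h Hh]; apply (@R_no_injection_nat (fun r => h (Hconst r))).
      intros x y Hxy.
      assert (E : Hconst x = Hconst y) by (apply Hh; [now exists x|now exists y|exact Hxy]).
      apply (f_equal (fun f : Hinf => Re (f disc0))) in E; exact E.
    - intros f g [x ->] [y ->] Hxy.
      assert (hxy : 0 < Rabs (x - y)).
      { apply Rabs_pos_lt; intros E; apply Hxy; f_equal; f_equal; lra. }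
      assert (E : Hminus (Hconst x) (Hconst y) = Hconst (x - y)%R).
      { apply Hinf_ext; intros z; simpl; rewrite RtoC_minus; ring. }
      set (u := fun n => Hnorm (Hminus (Nat.iter n (wcomp w phi) (Hconst x))
        (Nat.iter n (wcomp w phi) (Hconst y)))).
      assert (Eu : u = fun n => Hnorm (Nat.iter n (wcomp w phi) (Hconst (x - y)%R))).
      { apply functional_extensionality; intros n; unfold u.
        now rewrite iter_wcomp_Hminus, E. }
      change (LimInf_seq u = Finite 0 /\ Rbar_lt 0 (LimSup_seq u)); rewrite Eu.
      split; [apply Hinf0|].
      replace (LimSup_seq _) with p_infty; [exact I|].
      symmetry; apply LimSup_seq_p_infty_iff; intros M.
      destruct (Hub Hn (M / Rabs (x - y))) as [n Hlt]; exists n.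
      rewrite Hnorm_iter_wcomp_const, Cmod_R.
      rewrite Rmult_comm; apply Rlt_div_l; [exact hxy|exact Hlt]. }
  tauto.
Qed.
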